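(* \textsc{Coloring} can be solved in time $2^{\mathcal{O}(k\log k)}\cdot n^{\mathcal{O}(1)}$ on $n$-vertex graphs in $\textsc{Chordal}-ke$.
   Context: \textsc{Coloring}: given a graph $G$ and a positive integer $\ell$ (not fixed), decide whether $G$ has a proper coloring with at most $\ell$ colors. A graph is chordal if it has no induced cycle of length at least four; $\textsc{Chordal}-ke$ is the class of graphs that become chordal after adding at most $k$ edges. *)

(* Defs.v *)
From mathcomp Require Import all_boot.

Set Implicit Arguments.
Unset Strict Implicit.
Unset Printing Implicit Defensive.

Record sgraph (T : finType) := SGraph {
  adj :> rel T;
  adj_sym : symmetric adj;
  adj_irrefl : irreflexive adj
}.

Section Graphs.

Variable T : finType.
Implicit Types (G H : sgraph T) (s : seq T).

Definition edges G : {set {set T}} :=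
  [set [set p.1; p.2] | p : T * T & adj G p.1 p.2].

(* [s] lists the vertices of the cycle in cyclic order; every edge of G between
   two of them joins cyclically consecutive ones. *)
Definition induced_cycle G s : Prop :=
  [/\ 2 < size s, ucycle (adj G) s &
      {in s &, forall x y, adj G x y -> y = next s x \/ x = next s y}].

Definition chordal G : Prop :=
  forall s, 3 < size s -> ~ induced_cycle G s.

Definition chordal_ke (k : nat) G : Prop :=
  exists H, [/\ subrel (adj G) (adj H), #|edges H :\: edges G| <= k & chordal H].

(* The colouring need not be onto 'I_l, hence "at most l colours". *)
Definition colorable G (l : nat) : bool :=
  [exists f : {ffun T -> 'I_l}, forall x, forall y, adj G x y ==> (f x != f y)].

End Graphs.

(* Random access machine with uniform cost: natural-number registers, a
   natural-number memory with indirect addressing, and structured control flow.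
   The arithmetic is limited to addition and truncated subtraction: with
   unit-cost multiplication the machine would no longer be polynomially
   equivalent to Turing machines. *)

Inductive cmd : Type :=
| Skip
| Const (x c : nat)            (* r_x := c *)
| Add (x y z : nat)            (* r_x := r_y + r_z *)
| Sub (x y z : nat)            (* r_x := r_y - r_z, truncated at 0 *)
| Read (x y : nat)             (* r_x := mem[r_y] *)
| Write (x y : nat)            (* mem[r_x] := r_y *)
| Seq (c1 c2 : cmd)
| If (x : nat) (c1 c2 : cmd)   (* c1 if r_x <> 0, else c2 *)
| While (x : nat) (c : cmd).   (* repeat c as long as r_x <> 0 *)

Record state := State { reg : nat -> nat; mem : nat -> nat }.

Definition set_reg (s : state) (x v : nat) : state :=
  State [eta reg s with x |-> v] (mem s).

Definition set_mem (s : state) (a v : nat) : state :=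
  State (reg s) [eta mem s with a |-> v].

(* [exec c s t s']: started in state s, c halts in state s' after t steps, where
   every elementary instruction and every test of a condition is one step. *)
Inductive exec : cmd -> state -> nat -> state -> Prop :=
| exec_skip s : exec Skip s 1 s
| exec_const s x c : exec (Const x c) s 1 (set_reg s x c)
| exec_add s x y z : exec (Add x y z) s 1 (set_reg s x (reg s y + reg s z))
| exec_sub s x y z : exec (Sub x y z) s 1 (set_reg s x (reg s y - reg s z))
| exec_read s x y : exec (Read x y) s 1 (set_reg s x (mem s (reg s y)))
| exec_write s x y : exec (Write x y) s 1 (set_mem s (reg s x) (reg s y))
| exec_seq s s1 s2 c1 c2 t1 t2 :
    exec c1 s t1 s1 -> exec c2 s1 t2 s2 -> exec (Seq c1 c2) s (t1 + t2) s2
| exec_if_true s s1 x c1 c2 t :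
    reg s x != 0 -> exec c1 s t s1 -> exec (If x c1 c2) s t.+1 s1
| exec_if_false s s1 x c1 c2 t :
    reg s x = 0 -> exec c2 s t s1 -> exec (If x c1 c2) s t.+1 s1
| exec_while_true s s1 s2 x c t1 t2 :
    reg s x != 0 -> exec c s t1 s1 -> exec (While x c) s1 t2 s2 ->
    exec (While x c) s (t1 + t2).+1 s2
| exec_while_false s x c :
    reg s x = 0 -> exec (While x c) s 1 s.

(* An instance of Coloring: r_0 = n, r_1 = l, and the memory holds the adjacency
   matrix of G in row-major order from address 0; everything else is 0. *)
Definition coloring_input (n : nat) (G : sgraph 'I_n) (l : nat) : state :=
  State (nth 0 [:: n; l])
        (fun a => [exists u : 'I_n, exists v : 'I_n,
                     (a == u * n + v) && adj G u v] : nat).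

Definition accepts (s : state) : bool := reg s 0 != 0.

(* Main.v *)
(* An obstruction of a graph is a vertex v with two non-adjacent neighbours a
   and b that are connected outside the closed neighbourhood of v.  By Dirac's
   theorem a graph without obstruction has a perfect elimination ordering.  In
   a chordal supergraph H, an obstruction with a shortest path a = x_0, ...,
   x_D = b must acquire the chord ab or a chord v x_i; as every interior x_i or
   its predecessor is an end of an added edge, D is at most 4 k + 1.  Hence
   guessing one of 4 k + 1 chords at each of k steps leads to a chordal graph.
   Call the result H from now on.

   A colouring is encoded by the set of added edges with monochromatic
   ends.  Conversely, a labelling of the added edges as monochromatic or not,
   transitive on the triangles of H, comes from an l-colouring if and only if
   the greedy colouring along a perfect elimination ordering never needs more
   than l colours.  So the labels are guessed together with the chords; the
   budget K increases from 0 until some sequence of guesses reaches a chordal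
   graph, and the guesses for K are the numbers below (8 K + 2) ^ K.

   The machine only adds and subtracts, but on unbounded numbers and at unit
   cost, so subsets of [0, m) are stored in single registers as binary
   numerals, and every loop runs polynomially often in n, K and (8 K + 2) ^ K. *)
Require Import Defs.
From mathcomp Require Import all_boot zify ring.
From mathcomp Require boolp.

Set Implicit Arguments.
Unset Strict Implicit.
Unset Printing Implicit Defensive.

(** * Compilation of functions of the state to programs of polynomial running time *)

Definition poly_bounded (T : nat -> nat) : Prop :=
  exists C g, forall w, T w <= C * w.+1 ^ g.

Lemma poly_bounded_cst c : poly_bounded (fun=> c).
Proof. by exists c, 0 => w; rewrite expn0 muln1. Qed.

Lemma poly_bounded_id : poly_bounded id.
Proof. by exists 1, 1 => w; rewrite expn1 mul1n. Qed.

Lemma poly_boundedD T1 T2 :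
  poly_bounded T1 -> poly_bounded T2 -> poly_bounded (fun w => T1 w + T2 w).
Proof.
move=> [C1 [g1 H1]] [C2 [g2 H2]]; exists (C1 + C2), (g1 + g2) => w.
rewrite mulnDl leq_add //.
  by rewrite (leq_trans (H1 w)) // leq_mul2l leq_pexp2l ?leq_addr ?orbT.
by rewrite (leq_trans (H2 w)) // leq_mul2l leq_pexp2l ?leq_addl ?orbT.
Qed.

Lemma poly_boundedM T1 T2 :
  poly_bounded T1 -> poly_bounded T2 -> poly_bounded (fun w => T1 w * T2 w).
Proof.
move=> [C1 [g1 H1]] [C2 [g2 H2]]; exists (C1 * C2), (g1 + g2) => w.
by rewrite expnD mulnACA leq_mul.
Qed.

(** Registers are used as a stack: code at height [d] may overwrite every register from [d] on and
    must leave the lower ones and the memory alone. *)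
Definition agree (d : nat) (s s' : state) : Prop :=
  (forall i, i < d -> reg s' i = reg s i) /\ Defs.mem s' = Defs.mem s.

Lemma agree_trans d s1 s2 s3 : agree d s1 s2 -> agree d s2 s3 -> agree d s1 s3.
Proof.
move=> [H1 M1] [H2 M2]; split=> [i lt_id|]; last by rewrite M2.
by rewrite H2 // H1.
Qed.

Lemma agreeW d d' s s' : d <= d' -> agree d' s s' -> agree d s s'.
Proof. by move=> le [H M]; split=> // i lt; rewrite H // (leq_trans lt). Qed.

Lemma agree_set d s x v : d <= x -> agree d s (set_reg s x v).
Proof.
move=> le_dx; split=> // i lt_id /=; case: eqP => // eq_ix.
by move: lt_id; rewrite eq_ix ltnNge le_dx.
Qed.

(* Registers 0, 2 and 3 will hold n, the current budget K and the number of
   strings to enumerate; every loop runs polynomially often in their sum.  The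
   number of colours in register 1 never bounds a loop. *)
Definition weight (s : state) : nat := reg s 0 + reg s 2 + reg s 3.

Lemma agree_weight d s s' : 3 < d -> agree d s s' -> weight s' = weight s.
Proof. by move=> lt3d [H _]; rewrite /weight !H // (leq_trans _ lt3d). Qed.

Definition realizes (d : nat) (c : cmd) (F : state -> nat) (T : nat -> nat) : Prop :=
  forall s, exists t s',
    [/\ exec c s t s', t <= T (weight s), reg s' d = F s & agree d s s'].

(* Quantifying over the destination register makes weakening of contexts free. *)
Definition comp (d : nat) (F : state -> nat) : Prop :=
  [/\ 3 < d,
      forall s s', agree d s s' -> F s' = F s &
      forall d', d <= d' ->
        exists c T, poly_bounded T /\ realizes d' c F T].

Lemma compW d d' F : d <= d' -> comp d F -> comp d' F.
Proof.
move=> le [lt3 ext H]; split; first exact: leq_trans lt3 le.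
  by move=> s s' ag; apply: ext (agreeW le ag).
by move=> d2 le2; apply: H; apply: leq_trans le le2.
Qed.

Lemma eq_comp d F F' : F =1 F' -> comp d F -> comp d F'.
Proof.
move=> eqF [lt3 ext H]; split=> //; first by move=> s s' /ext; rewrite !eqF.
move=> d' /H [c [T [pT R]]]; exists c, T; split=> // s.
by have [t [s' [? ? ? ?]]] := R s; exists t, s'; rewrite -eqF.
Qed.

Lemma comp_cst d c : 3 < d -> comp d (fun=> c).
Proof.
move=> lt3; split=> // d' le; exists (Const d' c), (fun=> 1).
split; first exact: poly_bounded_cst.
move=> s; exists 1, (set_reg s d' c); split=> //; first exact: exec_const.
  by rewrite /= eqxx.
exact: agree_set.
Qed.

Lemma comp_reg d i : 3 < d -> i < d -> comp d (fun s => reg s i).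
Proof.
move=> lt3 lti; split=> //; first by move=> s s' [->].
(* There is no copy instruction: [d'] is cleared and serves as the zero summand. *)
move=> d' le; exists (Seq (Const d' 0) (Add d' i d')), (fun=> 2).
split; first exact: poly_bounded_cst.
move=> s; exists (1 + 1); eexists; split.
- by apply: exec_seq (exec_const _ _ _) (exec_add _ _ _ _).
- by [].
- by rewrite /= !eqxx addn0 ltn_eqF // (leq_trans lti).
- by apply: agree_trans (agree_set _ _ _) (agree_set _ _ _).
Qed.

Lemma comp_binop d (op : nat -> nat -> nat) (instr : nat -> nat -> nat -> cmd) F G :
  (forall s x y z,
     exec (instr x y z) s 1 (set_reg s x (op (reg s y) (reg s z)))) ->
  comp d F -> comp d G -> comp d (fun s => op (F s) (G s)).
Proof.
move=> Hop [lt3 extF HF] [_ extG HG]; split=> //.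
  by move=> s s' ag; rewrite (extF _ _ ag) (extG _ _ ag).
move=> d' le; have [cF [TF [pF RF]]] := HF _ le.
have [cG [TG [pG RG]]] := HG _ (leq_trans le (leqnSn d')).
exists (Seq cF (Seq cG (instr d' d' d'.+1))), (fun w => TF w + (TG w + 1)).
split; first by do 2?[apply: poly_boundedD => //]; apply: poly_bounded_cst.
move=> s; have [t1 [s1 [E1 L1 V1 A1]]] := RF s.
have [t2 [s2 [E2 L2 V2 A2]]] := RG s1.
exists (t1 + (t2 + 1)); eexists; split.
- by apply: exec_seq E1 _; apply: exec_seq E2 _; apply: Hop.
- rewrite leq_add // leq_add //.
  by rewrite -(agree_weight (leq_trans lt3 le) A1).
- rewrite /= eqxx V2 (extG _ _ (agreeW le A1)).
  by case: A2 => -> // _; rewrite V1.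
- apply: agree_trans A1 _; apply: agree_trans (agreeW (leqnSn _) A2) _.
  exact: agree_set.
Qed.

Lemma comp_add d F G : comp d F -> comp d G -> comp d (fun s => F s + G s).
Proof. by apply: (@comp_binop d addn Add) => s x y z; constructor. Qed.

Lemma comp_sub d F G : comp d F -> comp d G -> comp d (fun s => F s - G s).
Proof. by apply: (@comp_binop d subn Defs.Sub) => s x y z; constructor. Qed.

Lemma comp_mem d F : comp d F -> comp d (fun s => Defs.mem s (F s)).
Proof.
move=> [lt3 extF HF]; split=> //.
  by move=> s s' ag; rewrite (extF _ _ ag); case: ag => _ ->.
move=> d' le; have [c [T [pT RF]]] := HF _ le.
exists (Seq c (Read d' d')), (fun w => T w + 1).
split; first by apply: poly_boundedD => //; apply: poly_bounded_cst.
move=> s; have [t [s1 [E1 L1 V1 A1]]] := RF s.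
exists (t + 1); eexists; split; first by apply: exec_seq E1 _; apply: exec_read.
- by rewrite leq_add.
- by rewrite /= eqxx V1; case: A1 => _ ->.
- exact: agree_trans A1 (agree_set _ _ _).
Qed.

Definition bounded (F : state -> nat) : Prop :=
  exists2 T, poly_bounded T & forall s, F s <= T (weight s).

(** Every loop inside the algorithm goes through this lemma. Registers [d'] to [d' + 4] hold the
    accumulator, the bound, the index, the constant 1 and the number of remaining passes, and the
    body works from [d' + 5] on. The polynomial bound concerns the number of passes; the accumulator
    may become exponentially large. *)
Lemma comp_iteri d (b z : state -> nat) (f : state -> nat -> nat -> nat) :
  bounded b -> comp d b -> comp d z ->
  (forall d' J A, d <= d' -> comp d' J -> comp d' A ->
     comp d' (fun s => f s (J s) (A s))) ->
  comp d (fun s => iteri (b s) (f s) (z s)).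
Proof.
move=> [Tn pTn Hn] Cb Cz Cf.
have [lt3 extb Hb] := Cb; have [_ extz Hz] := Cz.
(* Applied to a constant index and accumulator, the hypothesis on [f] shows that [f s j a] depends
   only on the registers below [d] and the memory. *)
have extf s s' j a : agree d s s' -> f s' j a = f s j a.
  have [_ E _] := Cf d (fun=> j) (fun=> a) (leqnn _) (comp_cst j lt3) (comp_cst a lt3).
  exact: E.
have extI s s' m a : agree d s s' -> iteri m (f s') a = iteri m (f s) a.
  by move=> ag; elim: m => //= m ->; apply: extf.
split=> //.
  by move=> s s' ag; rewrite (extb _ _ ag) (extz _ _ ag); apply: extI.
move=> d' le.
have le5 : d <= d' + 5 by rewrite (leq_trans le) ?leq_addr.
have lt3' : 3 < d' + 5 by apply: leq_trans lt3 le5.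
have [cb [Tb [pb Rb]]] := Hb d'.+1 (leq_trans le (leqnSn d')).
have [cz [Tz [pz Rz]]] := Hz d'.+2 (leq_trans le (leq_trans (leqnSn d') (leqnSn d'.+1))).
have CJ : comp (d' + 5) (fun s => reg s d'.+2) 
  by apply: comp_reg => //; rewrite -addn2 ltn_add2l.
have CA : comp (d' + 5) (fun s => reg s d') 
  by apply: comp_reg => //; rewrite -[X in X < _]addn0 ltn_add2l.
have [_ _ /(_ _ (leqnn _)) [cf [Tf [pf Rf]]]] := Cf _ _ _ le5 CJ CA.
pose body := Seq cf (Seq (Const (d' + 6) 0) (Seq (Add d' (d' + 5) (d' + 6))
  (Seq (Add d'.+2 d'.+2 d'.+3) (Defs.Sub d'.+4 d'.+1 d'.+2)))).
pose init := Seq cb (Seq cz (Seq (Const d'.+3 0) (Seq (Add d' d'.+2 d'.+3)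
  (Seq (Const d'.+2 0) (Seq (Const d'.+3 1) (Defs.Sub d'.+4 d'.+1 d'.+2)))))).
exists (Seq init (While d'.+4 body)).
exists (fun w => (Tb w + (Tz w + 5)) + (Tn w * (Tf w + 6) + 1)).
split.
  repeat first [exact: poly_bounded_cst | exact: pTn | exact: pb | exact: pz |
    exact: pf | apply: poly_boundedD | apply: poly_boundedM].
move=> s.
(* Loop invariant with [m] passes to go, hence with index [b s - m]. *)
have loop m s1 : agree d' s s1 -> reg s1 d'.+1 = b s -> m <= b s ->
    reg s1 d'.+2 = b s - m -> reg s1 d'.+3 = 1 -> reg s1 d'.+4 = m ->
    reg s1 d' = iteri (b s - m) (f s) (z s) ->
    exists t s2, [/\ exec (While d'.+4 body) s1 t s2,
      t <= m * (Tf (weight s) + 5 + 1) + 1, reg s2 d' = iteri (b s) (f s) (z s) &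
      agree d' s s2].
  elim: m s1 => [|m IH] s1 A1 V1 leb V2 V3 V4 V0.
    exists 1, s1; rewrite subn0 in V0; split=> //.
    exact: exec_while_false.
  have [t1 [s2 [E2 L2 W2 A2]]] := Rf s1.
  have A2' := agreeW (leq_addr 5 d') A2.
  have lt5 i : i < 5 -> reg s2 (d' + i) = reg s1 (d' + i).
    by move=> lti; case: A2 => -> //; rewrite ltn_add2l.
  have R1 := lt5 1 isT; have R2 := lt5 2 isT; have R3 := lt5 3 isT.
  rewrite !(addn1, addn2, addn3) in R1 R2 R3.
  set s3 := set_reg s2 (d' + 6) 0.
  set s4 := set_reg s3 d' (reg s3 (d' + 5) + reg s3 (d' + 6)).
  set s5 := set_reg s4 d'.+2 (reg s4 d'.+2 + reg s4 d'.+3).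
  set s6 := set_reg s5 d'.+4 (reg s5 d'.+1 - reg s5 d'.+2).
  have Eb : exec body s1 (t1 + (1 + (1 + (1 + 1)))) s6.
    apply: exec_seq E2 _; apply: exec_seq (exec_const _ _ _) _.
    apply: exec_seq (exec_add _ _ _ _) _; apply: exec_seq (exec_add _ _ _ _) _.
    exact: exec_sub.
  have Rs : (reg s6 d' = reg s2 (d' + 5)) * (reg s6 d'.+1 = reg s1 d'.+1) *
     (reg s6 d'.+2 = reg s1 d'.+2 + reg s1 d'.+3) * (reg s6 d'.+3 = reg s1 d'.+3) *
     (reg s6 d'.+4 = reg s1 d'.+1 - (reg s1 d'.+2 + reg s1 d'.+3)).
    rewrite /s6 /s5 /s4 /s3 /=.
    split; [split; [split; [split|]|]|]; repeat (case: eqP => ?; try lia);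
      by rewrite ?addn0 ?R1 ?R2 ?R3.
  have A6 : agree d' s1 s6.
    apply: agree_trans A2' _; rewrite /s6 /s5 /s4 /s3.
    by do 3!(apply: agree_trans; last by apply: agree_set; lia); apply: agree_set; lia.
  have sub1 : (b s - m.+1) + 1 = b s - m by rewrite addn1 subnSK.
  have [|||||t2 [s7 [E7 L7 V7 A7]]] := IH s6 (agree_trans A1 A6) _ (ltnW leb).
  - by rewrite Rs V1.
  - by rewrite Rs V2 V3 sub1.
  - by rewrite Rs.
  - by rewrite Rs V1 V2 V3 sub1 subKn // ltnW.
  - rewrite Rs W2 -(subnSK leb) /= V2 V0; apply: extf; exact: agreeW A1.
  exists (t1 + (1 + (1 + (1 + 1))) + t2).+1, s7; split=> //.
    by apply: exec_while_true Eb E7; rewrite V4.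
  have := agree_weight (leq_trans lt3 le) A1 => eqW; rewrite eqW in L2.
  by rewrite mulSn; lia.
have [t1 [s1 [E1 L1 V1 A1]]] := Rb s.
have [t2 [s2 [E2 L2 V2 A2]]] := Rz s1.
rewrite (agree_weight _ A1) in L2; last by rewrite (leq_trans lt3) // ltnW.
set s3 := set_reg s2 d'.+3 0.
set s4 := set_reg s3 d' (reg s3 d'.+2 + reg s3 d'.+3).
set s5 := set_reg s4 d'.+2 0.
set s6 := set_reg s5 d'.+3 1.
set s7 := set_reg s6 d'.+4 (reg s6 d'.+1 - reg s6 d'.+2).
have Ei : exec init s (t1 + (t2 + (1 + (1 + (1 + (1 + 1)))))) s7.
  apply: exec_seq E1 _; apply: exec_seq E2 _.
  apply: exec_seq (exec_const _ _ _) _; apply: exec_seq (exec_add _ _ _ _) _.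
  apply: exec_seq (exec_const _ _ _) _; apply: exec_seq (exec_const _ _ _) _.
  exact: exec_sub.
have W1 : reg s2 d'.+1 = b s by case: A2 => ->.
have W2 : reg s2 d'.+2 = z s by rewrite V2; apply: extz; apply: agreeW A1; lia.
have Rs : (reg s7 d' = z s) * (reg s7 d'.+1 = b s) * (reg s7 d'.+2 = 0) *
    (reg s7 d'.+3 = 1) * (reg s7 d'.+4 = b s).
  rewrite /s7 /s6 /s5 /s4 /s3 /=.
  by split; [split; [split; [split|]|]|]; repeat (case: eqP => ?; try lia).
have A7 : agree d' s s7.
  apply: agree_trans (agreeW (leqnSn _) A1) _.
  apply: (agree_trans (agreeW _ A2)); first lia.
  rewrite /s7 /s6 /s5 /s4 /s3.
  by do 4!(apply: agree_trans; last by apply: agree_set; lia); apply: agree_set; lia.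
have [|||||||t3 [s8 [E8 L8 V8 A8]]] := loop (b s) s7; rewrite ?subnn ?Rs //.
exists (t1 + (t2 + (1 + (1 + (1 + (1 + 1))))) + t3), s8; split=> //.
  exact: exec_seq Ei E8.
have := Hn s; set w := weight s in L1 L2 L8 *; move=> lew.
have : b s * (Tf w + 5 + 1) <= Tn w * (Tf w + 6) by apply: leq_mul => //; lia.
lia.
Qed.

(** * Holes, simplicial vertices and fill edges *)

Section Holes.

Variables (T : finType) (e : rel T).
Hypothesis e_irr : irreflexive e.
Implicit Types (v a b x y z : T) (t D : nat) (p : nat -> T).

Definition free v a y := (y == a) || (y != v) && ~~ e v y.

(* The vertices at distance at most t from b, along paths whose vertices other
   than b and a are outside the closed neighbourhood of v. *)
Fixpoint ball v a b t : {set T} :=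
  if t is t'.+1 then
    ball v a b t' :|:
      [set y | free v a y && [exists z, (z \in ball v a b t') && e y z]]
  else [set b].

Definition linked v a b :=
  connect (fun y z => [&& e y z, (y == b) || free v a y & (z == b) || free v a z]) a b.

(** A shortest path from [a] to [b], described as a descent through the balls around [b], which is
    how the program follows it. That it is simple and chordless is derived from the minimality of
    [D]. *)
Definition geodesic v a b D p : Prop :=
  [/\ p 0 = a, a \in ball v a b D, forall t, t < D -> a \notin ball v a b t &
      forall i, i < D -> e (p i) (p i.+1) /\ p i.+1 \in ball v a b (D - i.+1)].

(* v, p 0 = a, ..., p D = b is an induced cycle of length at least four. *)
Definition hole v a b D p : Prop :=
  [/\ [/\ 1 < D, p 0 = a & p D = b], e v a /\ e v b,
      forall i j, i <= D -> j <= D -> p i = p j -> i = j,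
      forall i j, i < j -> j <= D -> e (p i) (p j) -> j = i.+1 &
      (forall i, i < D -> e (p i) (p i.+1)) /\
      (forall i, i <= D -> p i != v) /\
      (forall i, 0 < i < D -> ~~ e v (p i))].

Lemma ball_mono v a b t t' : t <= t' -> ball v a b t \subset ball v a b t'.
Proof.
move=> le; rewrite -(subnK le); elim: (t' - t) => //= m IH.
exact: subset_trans IH (subsetUl _ _).
Qed.

Lemma ball_step v a b t y z :
  free v a y -> e y z -> z \in ball v a b t -> y \in ball v a b t.+1.
Proof.
by move=> fy eyz zt; rewrite /= !inE fy /=; apply/orP; right; apply/existsP; exists z; rewrite zt.
Qed.

Lemma ball_free v a b t y : y \in ball v a b t -> (y == b) || free v a y.
Proof.
elim: t => [|t IH] /=; first by rewrite inE => ->.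
by rewrite !inE => /orP[/IH //|/andP[-> _]]; rewrite orbT.
Qed.

Lemma ball_pred v a b t y : y \in ball v a b t.+1 -> y \notin ball v a b t ->
  exists2 z, z \in ball v a b t & e y z.
Proof.
by rewrite /= !inE => /orP[->//|/andP[_ /existsP[z /andP[zt eyz]]] _]; exists z.
Qed.

(** A shortcut from a vertex of the path would, one edge earlier, be a shortcut from its
    predecessor, so the minimality of [D] at [a] propagates along the path. *)
Lemma geodesic_dist v a b D p i : geodesic v a b D p -> i <= D ->
  p i \in ball v a b (D - i) /\ forall t, t < D - i -> p i \notin ball v a b t.
Proof.
move=> [p0 aD minD step]; elim: i => [|i IH] leD; first by rewrite subn0 p0.
have [pi mini] := IH (ltnW leD); have [ei pS] := step i leD; split=> // t lt.
apply/negP => pt.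
have fi : free v a (p i).
  case/orP: (ball_free pi) => // /eqP pib.
  by have := mini 0; rewrite /= inE pib eqxx subn_gt0 => /(_ leD).
have := ball_step fi ei pt; apply/negP; apply: mini; lia.
Qed.

(** The vertex [p i] is at distance exactly [D - i] from [b]. So the vertices are distinct, and an
    edge that skips a vertex would shorten the distance of its first end. *)
Lemma geodesic_hole v a b D p : e v a -> e v b -> a != b -> ~~ e a b ->
  geodesic v a b D p -> hole v a b D p.
Proof.
move=> eva evb neab eab geo; have [p0 aD minD step] := geo.
have dist := geodesic_dist geo.
have pD : p D = b by have [] := dist D (leqnn D); rewrite subnn /= inE => /eqP.
have D0 : D != 0 by apply: contraNneq neab => D0; rewrite -p0 -pD D0.
have D1 : D != 1.
  by apply: contraNneq eab => D1; have [] := step 0; rewrite D1 // -D1 pD p0.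
have D2 : 1 < D by lia.
have inj i j : i <= D -> j <= D -> p i = p j -> i = j.
  move=> leiD lejD eqp; have [Bi mi] := dist i leiD; have [Bj mj] := dist j lejD.
  case: (ltngtP i j) => // lt.
    by have := mi (D - j); rewrite eqp Bj => /(_ ltac:(lia)).
  by have := mj (D - i); rewrite -eqp Bi => /(_ ltac:(lia)).
have fr i : i < D -> free v a (p i).
  move=> lti; have [/ball_free/orP[/eqP pib|//] _] := dist i (ltnW lti).
  by have := inj i D (ltnW lti) (leqnn D); rewrite pD => /(_ pib); lia.
have fr' i : 0 < i < D -> (p i != v) && ~~ e v (p i).
  case/andP=> i0 lti; case/orP: (fr i lti) => // /eqP pia.
  by have := inj i 0 (ltnW lti) (leq0n D); rewrite p0 => /(_ pia); lia.
split=> //.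
- move=> i j ltij lejD eij; have [Bj _] := dist j lejD.
  have ltiD : i < D by lia.
  have Bi := ball_step (fr i ltiD) eij Bj.
  have [_ mi] := dist i (ltnW ltiD).
  case: (ltngtP j i.+1) => // lt; first lia.
  by have := mi (D - j).+1; rewrite Bi => /(_ ltac:(lia)).
- split; first by move=> i /step[].
  split; last by move=> i /fr' /andP[].
  move=> i leiD; have [->|i0] := posnP i.
    by rewrite p0; apply: contraTneq eva => ->; rewrite e_irr.
  have [ltiD|leDi] := ltnP i D; first by have /andP[] := fr' i ltac:(lia).
  have -> : i = D by lia.
  by rewrite pD; apply: contraTneq evb => ->; rewrite e_irr.
Qed.

Lemma geodesic_exists v a b t :
  a \in ball v a b t -> exists D p, D <= t /\ geodesic v a b D p.
Proof.
move=> at_; have ex : exists t, a \in ball v a b t by exists t.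
case: (ex_minnP ex) => D aD minD; exists D.
have ltD t' : t' < D -> a \notin ball v a b t'.
  by move=> lt; apply/negP => /minD; rewrite leqNgt lt.
suff /(_ D a aD ltD) [p [p0 st]] : forall m y, y \in ball v a b m ->
    (forall t, t < m -> y \notin ball v a b t) -> exists p, p 0 = y /\
    forall i, i < m -> e (p i) (p i.+1) /\ p i.+1 \in ball v a b (m - i.+1).
  by exists p; split; [exact: minD | split].
elim=> [|m IH] y ym miny; first by exists (fun=> y).
have [z zm eyz] := ball_pred ym (miny m (leqnn _)).
have fy : free v a y.
  case/orP: (ball_free ym) => // /eqP yb.
  by have := miny 0 isT; rewrite /= inE yb eqxx.
have [t' lt|p [p0 st]] := IH z zm.
  by apply/negP => /(ball_step fy eyz); apply/negP; apply: miny.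
exists (fun i => if i is j.+1 then p j else y); split=> // -[|i] lti.
  by rewrite p0 subn1.
by rewrite subSS; apply: st.
Qed.

(** A path without repetitions has at most [#|T|] vertices. *)
Lemma linked_ball v a b : linked v a b -> a \in ball v a b #|T|.
Proof.
have walk s y :
    path (fun y z => [&& e y z, (y == b) || free v a y & (z == b) || free v a z]) y s ->
    b = last y s -> y \in ball v a b (size s).
  elim: s y => [|z s IH] y /=; first by move=> _ ->; rewrite inE.
  case/andP=> /and3P[eyz fy _] /IH{}IH /IH zb.
  case/orP: fy => [/eqP ->|fy]; last exact: ball_step fy eyz zb.
  by apply: (subsetP (ball_mono v a b (leq0n (size s).+1))); rewrite /= inE.
case/connectP => s pth; case: (shortenP pth) => s' pth' un _ eqb.
have le : size s' <= #|T|.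
  by apply: leq_trans (max_card (mem (a :: s'))); rewrite (card_uniqP un) /=.
exact: (subsetP (ball_mono v a b le)) (walk _ _ pth' eqb).
Qed.

Lemma linked_hole v a b : e v a -> e v b -> a != b -> ~~ e a b -> linked v a b ->
  exists D p, hole v a b D p.
Proof.
move=> eva evb neab eab /linked_ball/geodesic_exists [D [p [_ geo]]].
by exists D, p; apply: geodesic_hole.
Qed.

End Holes.

Lemma chordal_no_hole (T : finType) (H : sgraph T) v a b D p :
  chordal H -> ~ hole (adj H) v a b D p.
Proof.
move=> cH [[D2 p0 pD] [eva evb] inj ind [step [nev nadj]]].
(* The cycle [v, p 0, ..., p D]; its length [D + 2] is at least 4. *)
pose c i := if i is j.+1 then p j else v.
have injc i j : i < D.+2 -> j < D.+2 -> c i = c j -> i = j.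
  case: i j => [|i] [|j] //= lti ltj.
  - by move=> eqv; have := nev j; rewrite -eqv eqxx => /(_ ltac:(lia)).
  - by move=> eqv; have := nev i; rewrite eqv eqxx => /(_ ltac:(lia)).
  - by move=> /inj -> //; lia.
have un : uniq (mkseq c D.+2).
  by apply/mkseq_uniqP => i j lti ltj; apply: injc.
have nxt i : i < D.+2 -> next (mkseq c D.+2) (c i) = c (if i == D.+1 then 0 else i.+1).
  move=> lti; rewrite next_nth.
  have idx : index (c i) (mkseq c D.+2) = i.
    by rewrite -{1}(nth_mkseq (c 0) c lti) index_uniq // size_mkseq.
  have -> : c i \in mkseq c D.+2 by apply/mapP; exists i; rewrite ?mem_iota.
  rewrite idx; have -> : mkseq c D.+2 = c 0 :: map c (iota 1 D.+1) by [].
  move: (D.+1) lti => m lti /=.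
  case: eqP => [->|ne]; first by rewrite nth_default // size_map size_iota.
  by rewrite (nth_map 0) ?size_iota ?nth_iota // ?add1n //; lia.
have memc x : x \in mkseq c D.+2 -> exists2 i, i < D.+2 & x = c i.
  by case/mapP => i; rewrite mem_iota => /andP[_ lti] ->; exists i.
have adjc i j : i < j -> j < D.+2 -> adj H (c i) (c j) ->
    c j = next (mkseq c D.+2) (c i) \/ c i = next (mkseq c D.+2) (c j).
  move=> ltij ltj; have lti : i < D.+2 by lia.
  rewrite !nxt //; case: i j ltij ltj lti => [|i] [|j] //= ltij ltj lti eij.
    have [->|nej] := eqVneq j 0; first by left.
    have [->|neD] := eqVneq j D; first by rewrite eqxx; right.
    by have := nadj j ltac:(lia); rewrite eij.
  have -> : j = i.+1 by apply: ind.
  by left; case: eqP => //; lia.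
apply: (cH (mkseq c D.+2)); first by rewrite size_mkseq; lia.
split; first by rewrite size_mkseq; lia.
  rewrite /ucycle un andbT; apply: cycle_from_next => // x /memc[i lti ->].
  rewrite nxt //; case: i lti => [|i] lti /=; first by rewrite p0.
  case: eqP => [[->]|ne]; first by rewrite pD adj_sym.
  by apply: step; lia.
move=> x y /memc[i lti ->] /memc[j ltj ->] eij.
case: (ltngtP i j) => [lt|lt|eqij].
- exact: adjc.
- by rewrite adj_sym in eij; case: (adjc _ _ lt lti eij); [right|left].
- by rewrite eqij adj_irrefl in eij.
Qed.

(** If neither alternative holds, the walk in [W] avoids the closed neighbourhood of [v] except at
    [a] and [b], so a shortest such walk closes up with [v] to a hole of [H]. *)
Lemma chordal_chord (T : finType) (H : sgraph T) (W : pred T) v a b :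
  chordal H -> adj H v a -> adj H v b -> a != b -> ~~ W v ->
  connect (fun y z => [&& adj H y z, W y & W z]) a b ->
  adj H a b \/ exists w, [/\ W w, w != a, w != b & adj H v w].
Proof.
move=> cH eva evb neab Wv con.
have [?|eab] := boolP (adj H a b); [by left | right].
have [/existsP[w /and4P[]]|] := boolP [exists w, [&& W w, w != a, w != b & adj H v w]].
  by exists w.
rewrite negb_exists => /forallP noW.
suff [D [p]] : exists D p, hole (adj H) v a b D p by move/chordal_no_hole => /(_ cH).
apply: (linked_hole (@adj_irrefl _ H)) => //.
have okW w : W w -> (w == b) || free (adj H) v a w.
  move=> Ww; have := noW w; rewrite Ww /= /free !negb_and !negbK.
  case: (w == a); first by rewrite orbT.
  case: (w == b) => //= ->; rewrite andbT.
  by apply: contraNneq Wv => <-.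
apply: connect_sub con => y z /and3P[eyz Wy Wz]; apply: connect1.
by rewrite eyz !okW.
Qed.

Definition rel_edges (T : finType) (e : rel T) : {set {set T}} :=
  [set [set p.1; p.2] | p : T * T & e p.1 p.2].

Lemma set2_eq (T : finType) (x y x' y' : T) :
  [set x; y] = [set x'; y'] -> x = x' /\ y = y' \/ x = y' /\ y = x'.
Proof.
move=> eqs.
have := set21 x y; have := set22 x y; rewrite eqs => /set2P yE /set2P xE.
have := set21 x' y'; have := set22 x' y'; rewrite -eqs => /set2P yE' /set2P xE'.
by case: xE yE xE' yE' => [->|->] [->|->] [?|?] [?|?]; auto.
Qed.

Lemma mem_rel_edges (T : finType) (e : rel T) x y :
  symmetric e -> ([set x; y] \in rel_edges e) = e x y.
Proof.
move=> se; apply/imsetP/idP => [[[u w]]|exy]; last by exists (x, y); rewrite ?inE.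
by rewrite inE /= => euw /set2_eq[[-> ->]|[-> ->]] //; rewrite se.
Qed.

Definition fill_vertices (T : finType) (H e : rel T) : {set T} :=
  [set x | [exists y, H x y && ~~ e x y]].

Lemma card_fill_vertices (T : finType) (H e : rel T) :
  symmetric H -> symmetric e ->
  #|fill_vertices H e| <= 2 * #|rel_edges H :\: rel_edges e|.
Proof.
move=> sH se; set F := _ :\: _.
have sub : fill_vertices H e \subset cover F.
  apply/subsetP => x; rewrite inE => /existsP[y /andP[Hxy exy]].
  by apply/bigcupP; exists [set x; y]; rewrite ?set21 // inE !mem_rel_edges // Hxy exy.
apply: leq_trans (subset_leq_card sub) _; apply: leq_trans (leq_card_cover F) _.
rewrite mulnC -sum_nat_const; apply: leq_sum => A; rewrite inE => /andP[_ /imsetP[q _ ->]].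
by rewrite cards2; case: eqP.
Qed.

Section Fill.

Variables (T : finType) (H : sgraph T) (e : rel T).
Hypotheses (e_sym : symmetric e) (cH : chordal H) (eH : subrel e (adj H)).

(** The rest of the hole joins the two neighbours of [p i] on it the other way round, through [v].
    Chordality of [H] then yields a chord between these two neighbours, or an edge of [H] from [p i]
    to another vertex of the hole; either is absent from [e]. *)
Lemma hole_fill_vertices v a b D p i : hole e v a b D p -> 0 < i < D ->
  (p i \in fill_vertices (adj H) e) || (p i.-1 \in fill_vertices (adj H) e).
Proof.
move=> [[D2 p0 pD] [eva evb] inj ind [step [nev nadj]]].
case: i => [//|i] ltiD; rewrite [_.-1]/=.
pose W w := (w == v) || [exists j : 'I_D.+1, (p j == w) && (j != i.+1 :> nat)].
have Wp j : j <= D -> j != i.+1 -> W (p j).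
  move=> lej nej; apply/orP; right; apply/existsP.
  by exists (Ordinal (lej : j < D.+1)); rewrite eqxx.
have Wv : W v by rewrite /W eqxx.
have We w : W w -> w != p i -> w != p i.+2 -> ~~ e (p i.+1) w.
  case/orP => [/eqP -> _ _|/existsP[j /andP[/eqP <- nej]] ni ni2]; first by rewrite e_sym nadj.
  have ltj := ltn_ord j; apply/negP => eij.
  case: (ltngtP (i.+1) j) => [lt|lt|eqj]; last by rewrite eqj eqxx in nej.
    by move: ni2; rewrite (ind _ _ lt _ eij) ?eqxx //.
  by move: eij ni; rewrite e_sym => /(ind _ _ lt ltac:(lia)) [->]; rewrite eqxx.
have NW : ~~ W (p i.+1).
  apply/negP => /orP[/eqP pv|/existsP[j /andP[/eqP /inj eqj nej]]].
    by have := nev i.+1 ltac:(lia); rewrite pv eqxx.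
  have ltj := ltn_ord j.
  by rewrite eqj ?eqxx // in nej; lia.
set r := fun y z => [&& adj H y z, W y & W z].
have up j m : (forall q, j <= q <= j + m -> q != i.+1) ->
    j + m <= D -> connect r (p j) (p (j + m)).
  elim: m => [|m IH] ne le; first by rewrite addn0.
  apply: connect_trans (IH _ _) _; [by move=> q lq; apply: ne; lia | lia |].
  rewrite addnS; apply: connect1; rewrite /r eH; last by apply: step; lia.
  by rewrite !Wp //; try lia; apply: ne; lia.
(* After the shift the middle vertex is [p i.+1]; the arc runs from [p i.+2] up to [p D], through
   [v], and from [p 0] up to [p i]. *)
have con : connect r (p i.+2) (p i).
  apply: (@connect_trans _ _ (p D)).
    by have := up i.+2 (D - i.+2); rewrite subnKC; [apply=> //; lia | lia].
  apply: (@connect_trans _ _ v).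
    by apply: connect1; rewrite /r Wv Wp ?andbT ?eH //; [rewrite pD e_sym | lia].
  apply: (@connect_trans _ _ (p 0)).
    by apply: connect1; rewrite /r Wv Wp ?andbT ?eH // p0.
  by have := up 0 i; rewrite add0n; apply; lia.
have ltS : i.+1 < D by lia.
have [|||Hab|[w [Ww w2 w0 Hw]]] := chordal_chord cH _ _ _ NW con.
- by apply: eH; apply: step.
- by rewrite adj_sym; apply: eH; apply: step; lia.
- by apply/eqP => /inj; lia.
- apply/orP; right; rewrite inE; apply/existsP; exists (p i.+2).
  rewrite adj_sym Hab /=; apply/negP => /ind; lia.
- apply/orP; left; rewrite inE; apply/existsP; exists w.
  by rewrite Hw We.
Qed.

Lemma hole_length v a b D p : hole e v a b D p ->
  D <= (4 * #|rel_edges (adj H) :\: rel_edges e|).+1.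
Proof.
move=> hl; have touched i := hole_fill_vertices (i := i) hl.
have leV := card_fill_vertices (@adj_sym _ H) e_sym.
case: hl => [[D2 p0 pD] _ inj _ _].
set V := fill_vertices _ _ in touched leV; clearbody V.
(* The indices below [D] are 0, those at a fill vertex and those just after one. The last two kinds
   number at most [#|V|] each, and [V] has at most two vertices per added edge. *)
pose I := [set i : 'I_D | p i \in V]; pose J := [set i : 'I_D | p i.-1 \in V & i != 0 :> nat].
have leI : #|I| <= #|V|.
  rewrite -(card_in_imset (f := fun i : 'I_D => p i)).
    by apply: subset_leq_card; apply/subsetP => _ /imsetP[i + ->]; rewrite inE.
  by move=> i j _ _ /inj eqp; apply/val_inj; apply: eqp; apply: ltnW.
have leJ : #|J| <= #|V|.
  rewrite -(card_in_imset (f := fun i : 'I_D => p i.-1)).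
    by apply: subset_leq_card; apply/subsetP => _ /imsetP[i + ->]; rewrite inE => /andP[].
  move=> i j; rewrite !inE => /andP[_ i0] /andP[_ j0] /inj eqp; apply/val_inj => /=.
  by have := ltn_ord i; have := ltn_ord j => ? ?; have := eqp ltac:(lia) ltac:(lia); lia.
have D0 : 0 < D by lia.
have cov : [set: 'I_D] \subset (Ordinal D0) |: (I :|: J).
  apply/subsetP => i _; rewrite !inE.
  have [//|i0 /=] := boolP (i == Ordinal D0).
  have ipos : 0 < i by move: i0; rewrite -val_eqE /=; lia.
  have /orP[->|->] := touched i ltac:(rewrite ipos ltn_ord //);
    by rewrite ?orbT //= -lt0n ipos orbT.
have leIJ : #|I :|: J| <= #|V| + #|V|.
  by apply: leq_trans (leq_card_setU I J) _; apply: leq_add.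
have := subset_leq_card cov; rewrite cardsT card_ord cardsU1.
move/leq_trans; apply; rewrite -add1n leq_add ?leq_b1 // (leq_trans leIJ) //.
by move: leV; clear; lia.
Qed.

(** The chord that a hole must acquire is coded by one number: 0 stands for the pair [a], [b], and
    [d > 0] for the pair [v], [p d]. By [hole_length] the range of [d] depends only on the number of
    added edges. *)
Lemma hole_chord v a b D p : hole e v a b D p -> ~~ e a b ->
  exists d, [/\ d <= 4 * #|rel_edges (adj H) :\: rel_edges e|, d < D &
    let x := if d == 0 then a else v in let y := if d == 0 then b else p d in
    adj H x y && ~~ e x y].
Proof.
move=> hl neab; have len := hole_length hl.
have [[D2 p0 pD] [eva evb] inj ind [step [nev nadj]]] := hl.
pose W w := [exists j : 'I_D.+1, (p j == w)].
have Wp j : j <= D -> W (p j).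
  by move=> lej; apply/existsP; exists (Ordinal (lej : j < D.+1)).
have con m : m <= D -> connect (fun y z => [&& adj H y z, W y & W z]) (p 0) (p m).
  elim: m => [|m IH] le //; apply: connect_trans (IH (ltnW le)) _; apply: connect1.
  by rewrite eH ?step // !Wp // ltnW.
have := con D (leqnn D); rewrite p0 pD => /(chordal_chord cH (eH eva) (eH evb)).
case.
- by rewrite -p0 -pD; apply/eqP => /inj; lia.
- apply/existsP => -[j /eqP pj].
  by have := nev j; rewrite pj eqxx => /(_ ltac:(rewrite -ltnS ltn_ord //)).
- by move=> Hab; exists 0; rewrite /= Hab; split=> //; lia.
- move=> [w [/existsP[j /eqP <-]]] wa wb Hw; have ltj := ltn_ord j.
  have j0 : j != 0 :> nat by apply: contraNneq wa => ->; rewrite p0.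
  have jD : j != D :> nat by apply: contraNneq wb => ->; rewrite pD.
  exists j; split; [lia | lia |].
  by rewrite (negPf j0) /= Hw nadj //; lia.
Qed.

End Fill.

Definition clique (T : finType) (e : rel T) (K : {set T}) : Prop :=
  {in K &, forall x y, x != y -> e x y}.

Section Simplicial.

Variables (T : finType) (e : rel T).
Hypotheses (e_sym : symmetric e) (e_irr : irreflexive e).
Hypothesis no_hole : forall v a b,
  e v a -> e v b -> a != b -> ~~ e a b -> ~~ linked e v a b.

(* Dirac's theorem, in a form that is its own induction hypothesis. *)
Lemma simplicial_outside_clique (U K : {set T}) u : clique e K ->
  u \in U -> u \notin K ->
  exists v, [/\ v \in U, v \notin K & clique e [set a in U | e v a]].
Proof.
have [m] := ubnP #|U|; elim: m => // m IH in U K u * => leU clK uU uK.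
have [/forall_inP full|] :=
  boolP [forall x in U, [forall y in U, (x != y) ==> e x y]].
  exists u; split=> // a b; rewrite !inE => /andP[aU _] /andP[bU _].
  by have /forall_inP/(_ b bU)/implyP := full a aU.
rewrite negb_forall_in => /exists_inP[x xU]; rewrite negb_forall_in => /exists_inP[z zU].
rewrite negb_imply => /andP[nexz xz].
(* The component [C] of [z] away from [x] is cut off by its attachments [S], all of which turn out
   to be neighbours of [x]. *)
pose U1 := [set y in U | (y != x) && ~~ e x y].
pose r := fun y z => [&& e y z, y \in U1 & z \in U1].
have r_sym : connect_sym r.
  by apply: sym_connect_sym => y w; rewrite /r e_sym [X in _ && X]andbC.
pose C := [set y in U1 | connect r z y].
pose S := [set s in U :\: C | [exists c in C, e s c]].
have zC : z \in C by rewrite !inE zU eq_sym nexz xz connect0.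
have CU1 : {subset C <= U1} by move=> y; rewrite inE => /andP[].
have U1U : {subset U1 <= U} by move=> y; rewrite inE => /andP[].
have Cclosed c y : c \in C -> y \in U1 -> e c y -> y \in C.
  move=> cC yU1 ecy; rewrite inE yU1 /=.
  have := cC; rewrite inE => /andP[cU1 /connect_trans]; apply.
  by apply: connect1; rewrite /r ecy cU1 yU1.
have xC : x \notin C by rewrite !inE eqxx andbF.
have Sx s : s \in S -> e x s.
  rewrite inE => /andP[/setDP[sU sC] /exists_inP[c cC esc]].
  apply: contraNT sC => exs; apply: (Cclosed c) => //; last by rewrite e_sym.
  rewrite inE sU exs andbT; apply: contraTneq esc => ->.
  by have := CU1 _ cC; rewrite inE => /and3P[].
(* Two non-adjacent vertices of [S] would be linked through [C], outside the closed neighbourhood of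
   [x]. *)
have clS : clique e S.
  move=> s1 s2 s1S s2S ne; apply: contraT => es.
  apply: contraNT (no_hole (Sx _ s1S) (Sx _ s2S) ne es) => _.
  have SC s : s \in S -> exists2 c, c \in C & e s c.
    by rewrite inE => /andP[_ /exists_inP].
  have [c1 c1C e1] := SC s1 s1S; have [c2 c2C e2] := SC s2 s2S.
  have okC c : c \in C -> (c == s2) || free e x s1 c.
    by move/CU1; rewrite inE /free => /and3P[_ -> ->]; rewrite !orbT.
  have ok1 : (s1 == s2) || free e x s1 s1 by rewrite /free eqxx orbT.
  apply: (@connect_trans _ _ c1); first by apply: connect1; rewrite e1 ok1 okC.
  apply: (@connect_trans _ _ c2); last by apply: connect1; rewrite e_sym e2 okC //= eqxx.
  have : connect r c1 c2.
    move: c1C c2C; rewrite !inE => /andP[_ + ] /andP[_]; rewrite (r_sym z c1).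
    exact: connect_trans.
  apply: connect_sub => y w /and3P[eyw].
  rewrite !inE => /and3P[_ ny ey] /and3P[_ nw ew].
  by apply: connect1; rewrite eyw /free ny ey nw ew !orbT.
(* If [K] misses [C], induction on [C :|: S] with the clique [S] gives a vertex of [C], and all its
   neighbours in [U] lie in [C :|: S]. *)
have [KC|] := boolP [disjoint K & C].
  have ltU : #|C :|: S| < m.
    apply: leq_trans (_ : #|U| <= m); last by rewrite -ltnS.
    apply: proper_card; apply/properP; split.
      apply/subsetP => y /setUP[/CU1/U1U //|].
      by rewrite inE => /andP[/setDP[]].
    exists x => //; rewrite in_setU (negPf xC) /=.
    by apply/negP => /Sx; rewrite e_irr.
  have zS : z \notin S by rewrite !inE connect0 zU eq_sym nexz xz.
  have [|v [vCS vS clv]] := IH (C :|: S) S z ltU clS _ zS; first by rewrite in_setU zC.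
  have vC : v \in C by move: vCS; rewrite in_setU (negPf vS) orbF.
  exists v; split; [exact/U1U/CU1 | by rewrite (disjointFl KC) |].
  have sub a : a \in [set a in U | e v a] -> a \in [set a in C :|: S | e v a].
    rewrite inE => /andP[aU eva]; rewrite inE eva andbT in_setU.
    have [//|aC] := boolP (a \in C).
    by rewrite inE in_setD aC aU /=; apply/exists_inP; exists v; rewrite // e_sym.
  by move=> a b /sub aCS /sub bCS; apply: clv.
(* If [K] meets [C], induction on [U :\: C] with the clique [S] gives a vertex without neighbours in
   [C], hence outside [K]. *)
case/pred0Pn => k /= /andP[kK kC].
have ltU : #|U :\: C| < m.
  apply: leq_trans (_ : #|U| <= m); last by rewrite -ltnS.
  apply: proper_card; apply/properP; split; first exact: subsetDl.
  by exists z => //; rewrite in_setD zC.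
have xS : x \notin S by apply/negP => /Sx; rewrite e_irr.
have [|v [vUC vS clv]] := IH (U :\: C) S x ltU clS _ xS; first by rewrite in_setD xC.
have noC c : c \in C -> ~~ e v c.
  move=> cC; apply: contra vS => evc; rewrite inE vUC /=.
  by apply/exists_inP; exists c.
exists v; split; first by case/setDP: vUC.
  apply/negP => vK; have := noC k kC; rewrite clK //.
  by apply: contraTneq kC => <-; case/setDP: vUC.
have sub a : a \in [set a in U | e v a] -> a \in [set a in U :\: C | e v a].
  rewrite inE => /andP[aU eva]; rewrite inE eva andbT in_setD aU andbT.
  by apply: contraL eva; apply: noC.
by move=> a b /sub aUC /sub bUC; apply: clv.
Qed.

End Simplicial.

Lemma fill_decrease (T : finType) (H e e' : rel T) x y j :
  symmetric e -> symmetric e' -> symmetric H ->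
  subrel e e' -> H x y -> ~~ e x y -> e' x y ->
  #|rel_edges H :\: rel_edges e| <= j.+1 -> #|rel_edges H :\: rel_edges e'| <= j.
Proof.
move=> se se' sH sub Hxy exy e'xy le; rewrite -ltnS; apply: leq_trans le.
apply: proper_card; apply/properP; split.
  apply: setDS; apply/subsetP => _ /imsetP[p + ->].
  by rewrite inE => /sub ?; rewrite mem_rel_edges.
by exists [set x; y]; rewrite !inE !mem_rel_edges ?exy ?Hxy ?e'xy.
Qed.

(** * The algorithm as a function computed by the machine *)

Definition compb (d : nat) (P : state -> bool) : Prop := comp d (fun s => P s : nat).

Lemma comp_gt3 d F : comp d F -> 3 < d. Proof. by case. Qed.

Lemma comp_succ d F : comp d F -> comp d (fun s => (F s).+1).
Proof.
move=> cF; apply: (@eq_comp _ (fun s => F s + 1)); first by move=> s; rewrite addn1.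
by apply: comp_add => //; apply: comp_cst; case: cF.
Qed.

Lemma comp_pred d F : comp d F -> comp d (fun s => (F s).-1).
Proof.
move=> cF; apply: (@eq_comp _ (fun s => F s - 1)); first by move=> s; rewrite subn1.
by apply: comp_sub => //; apply: comp_cst; case: cF.
Qed.

Lemma compb_not d P : compb d P -> compb d (fun s => ~~ P s).
Proof.
move=> cP; apply: (@eq_comp _ (fun s => 1 - P s)); first by move=> s; case: (P s).
by apply: comp_sub => //; apply: comp_cst; case: cP.
Qed.

Lemma compb_and d P Q : compb d P -> compb d Q -> compb d (fun s => P s && Q s).
Proof.
move=> cP cQ; apply: (@eq_comp _ (fun s => P s + Q s - 1)).
  by move=> s; case: (P s) (Q s) => [] [].
by apply: comp_sub; [exact: comp_add | apply: comp_cst; case: cP].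
Qed.

Lemma compb_or d P Q : compb d P -> compb d Q -> compb d (fun s => P s || Q s).
Proof.
move=> cP cQ; apply: (@eq_comp _ (fun s => ~~ (~~ P s && ~~ Q s))).
  by move=> s; rewrite negb_and !negbK.
by apply: compb_not; apply: compb_and; apply: compb_not.
Qed.

Lemma compb_imply d P Q : compb d P -> compb d Q -> compb d (fun s => P s ==> Q s).
Proof.
move=> cP cQ; apply: (@eq_comp _ (fun s => ~~ P s || Q s)).
  by move=> s; rewrite implybE.
by apply: compb_or => //; apply: compb_not.
Qed.

Lemma compb_leq d F G : comp d F -> comp d G -> compb d (fun s => F s <= G s).
Proof.
move=> cF cG; apply: (@eq_comp _ (fun s => 1 - (F s - G s))); first by move=> s; lia.
by apply: comp_sub; [apply: comp_cst; case: cF | apply: comp_sub].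
Qed.

Lemma compb_ltn d F G : comp d F -> comp d G -> compb d (fun s => F s < G s).
Proof. by move=> cF cG; apply: compb_leq => //; apply: comp_succ. Qed.

Lemma compb_eq d F G : comp d F -> comp d G -> compb d (fun s => F s == G s).
Proof.
move=> cF cG; apply: (@eq_comp _ (fun s => (F s <= G s) && (G s <= F s))).
  by move=> s; rewrite eqn_leq.
by apply: compb_and; apply: compb_leq.
Qed.

Lemma bounded_cst c : bounded (fun=> c).
Proof. by exists (fun=> c) => //; apply: poly_bounded_cst. Qed.

Lemma bounded_add F G : bounded F -> bounded G -> bounded (fun s => F s + G s).
Proof.
move=> [T pT HT] [T' pT' HT']; exists (fun w => T w + T' w).
  exact: poly_boundedD.
by move=> s; apply: leq_add.
Qed.

Lemma bounded_mul F G : bounded F -> bounded G -> bounded (fun s => F s * G s).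
Proof.
move=> [T pT HT] [T' pT' HT']; exists (fun w => T w * T' w).
  exact: poly_boundedM.
by move=> s; apply: leq_mul.
Qed.

Lemma bounded_succ F : bounded F -> bounded (fun s => (F s).+1).
Proof.
move=> bF; have [T pT HT] := bounded_add (bounded_cst 1) bF.
by exists T => // s; rewrite -add1n.
Qed.

(** A conditional is a loop with at most one pass, so no further control construct has to be
    compiled. *)
Lemma comp_if d P F G : compb d P -> comp d F -> comp d G ->
  comp d (fun s => if P s then F s else G s).
Proof.
move=> cP cF cG; apply: (@eq_comp _ (fun s => iteri (P s) (fun _ _ => F s) (G s))).
  by move=> s; case: (P s).
apply: comp_iteri => //.
  by exists (fun=> 1); [apply: poly_bounded_cst | move=> s; case: (P s)].
by move=> d' J A le _ _; apply: compW cF.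
Qed.

(** For predicates tested inside a loop: the loop index lives in a register above [d], hence the
    quantification over [d'] and [J]. *)
Definition compb_under d (P : state -> pred nat) : Prop :=
  forall d' J, d <= d' -> comp d' J -> compb d' (fun s => P s (J s)).

Lemma count_iteri p b : count p (iota 0 b) = iteri b (fun j a => a + p j) 0.
Proof. by elim: b => // b IH; rewrite -[in LHS]addn1 iotaD count_cat IH /= addn0. Qed.

(** The accumulator equals the index exactly as long as no hit has occurred, and stops at the first
    hit. *)
Lemma find_iteri p b :
  find p (iota 0 b) = iteri b (fun j a => if (a == j) && ~~ p j then a.+1 else a) 0.
Proof.
elim: b => // b IH; rewrite -[in LHS]addn1 iotaD find_cat /= -IH add0n size_iota.
case: (boolP (has p (iota 0 b))) => [hp|nhp].
  by rewrite ltn_eqF //; move: hp; rewrite has_find size_iota.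
by rewrite (hasNfind nhp) size_iota eqxx; case: (p b); rewrite ?addn0 ?addn1.
Qed.

Lemma comp_count d b P : bounded b -> comp d b -> compb_under d P ->
  comp d (fun s => count (P s) (iota 0 (b s))).
Proof.
move=> bb cb cP; apply: eq_comp (fun s => esym (count_iteri _ _)) _.
apply: comp_iteri => //; first by apply: comp_cst; case: cb.
by move=> d' J A le cJ cA; apply: comp_add => //; apply: cP.
Qed.

Lemma comp_find d b P : bounded b -> comp d b -> compb_under d P ->
  comp d (fun s => find (P s) (iota 0 (b s))).
Proof.
move=> bb cb cP; apply: eq_comp (fun s => esym (find_iteri _ _)) _.
apply: comp_iteri => //; first by apply: comp_cst; case: cb.
move=> d' J A le cJ cA; apply: comp_if => //; last exact: comp_succ.
by apply: compb_and; [apply: compb_eq | apply: compb_not; apply: cP].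
Qed.

Lemma compb_has d b P : bounded b -> comp d b -> compb_under d P ->
  compb d (fun s => has (P s) (iota 0 (b s))).
Proof.
move=> bb cb cP; apply: (@eq_comp _ (fun s => 0 < count (P s) (iota 0 (b s)))).
  by move=> s; rewrite has_count.
by apply: compb_ltn; [apply: comp_cst; case: cb | apply: comp_count].
Qed.

Lemma compb_all d b P : bounded b -> comp d b -> compb_under d P ->
  compb d (fun s => all (P s) (iota 0 (b s))).
Proof.
move=> bb cb cP.
apply: (@eq_comp _ (fun s => ~~ has (fun i => ~~ P s i) (iota 0 (b s)))).
  by move=> s; rewrite has_predC negbK.
by apply: compb_not; apply: compb_has => // d' J le cJ; apply: compb_not; apply: cP.
Qed.

Lemma muln_iteri x y : x * y = iteri y (fun _ a => a + x) 0.
Proof. by elim: y => [|y /= <-]; rewrite ?muln0 // mulnS addnC. Qed.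

(** Repeated addition of the first factor; the second one bounds the loop. *)
Lemma comp_mul d F G : bounded G -> comp d F -> comp d G -> comp d (fun s => F s * G s).
Proof.
move=> bG cF cG; apply: eq_comp (fun s => esym (muln_iteri _ _)) _.
apply: comp_iteri => //; first by apply: comp_cst; case: cF.
by move=> d' J A le _ cA; apply: comp_add => //; apply: compW cF.
Qed.

(* 2 ^ minn m i, with a number of iterations that does not depend on i *)
Definition pow2 m i := iteri m (fun j a => if j < i then a + a else a) 1.

Lemma pow2E m i : pow2 m i = 2 ^ minn m i.
Proof.
rewrite /pow2; elim: m => [|m /= ->]; first by rewrite min0n.
case: ltnP => [lt|le]; last by congr (2 ^ _); lia.
by rewrite addnn -mul2n -expnS; congr (2 ^ _); lia.
Qed.

(* A subset p of [0, m) is coded by the number with binary digits p. *)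
Definition table m (p : pred nat) :=
  iteri m (fun j a => if p j then a + pow2 m j else a) 0.

(** The digits above [i] are subtracted from the top down, and the remainder is compared with
    [2 ^ i]. For [m <= i] the threshold is [2 ^ m], which no code reaches. *)
Definition bit m x i :=
  pow2 m i <= iteri m (fun j a =>
    if (i < m - j.+1) && (pow2 m (m - j.+1) <= a) then a - pow2 m (m - j.+1) else a) x.

Lemma bit_table m p i : bit m (table m p) i = (i < m) && p i.
Proof.
pose t k := \sum_(j < k) p j * 2 ^ j.
have tS k : t k.+1 = t k + p k * 2 ^ k by rewrite /t big_ord_recr.
have ltt k : t k < 2 ^ k.
  elim: k => [|k IH]; first by rewrite /t big_ord0.
  by rewrite tS expnS; case: (p k); lia.
have tE k : k <= m -> iteri k (fun j a => if p j then a + pow2 m j else a) 0 = t k.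
  elim: k => [|k IH] le; first by rewrite /t big_ord0.
  rewrite /= IH ?(ltnW le) // tS pow2E (minn_idPr (ltnW le)).
  by case: (p k); rewrite ?mul1n ?addn0.
rewrite /bit /table tE //; set F := fun j a => _.
(* After [k] passes the digits from [m - k] on are gone, except that those up to [i] always stay. *)
have clear k : k <= m -> iteri k F (t m) = t (if i < m then maxn (m - k) i.+1 else m).
  elim: k => [|k IH] le /=.
    by case: ifP => // lt; congr t; lia.
  rewrite IH ?(ltnW le) // /F; have := ltt (m - k.+1).
  have -> : pow2 m (m - k.+1) = 2 ^ (m - k.+1).
    by rewrite pow2E; congr (2 ^ _); lia.
  case: (ltnP i m) => [ltim|leim].
    2: by case: (ltnP i (m - k.+1)) => //; lia.
  case: (ltnP i (m - k.+1)) => [lt|ge] ltk /=.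
    have -> : maxn (m - k) i.+1 = (m - k.+1).+1 by lia.
    have -> : maxn (m - k.+1) i.+1 = m - k.+1 by lia.
    by rewrite tS; case: (p _); rewrite ?mul1n ?mul0n; case: leqP; lia.
  by congr t; lia.
rewrite clear // subnn max0n pow2E; case: ltnP => [ltim|leim].
  by rewrite tS; have := ltt i; case: (p i); rewrite ?mul1n ?mul0n /=; lia.
by rewrite leqNgt ltt.
Qed.

Lemma comp_pow2 d m i : bounded m -> comp d m -> comp d i ->
  comp d (fun s => pow2 (m s) (i s)).
Proof.
move=> bm cm ci; apply: comp_iteri => //; first by apply: comp_cst; case: cm.
move=> d' J A le cJ cA; apply: comp_if => //; last exact: comp_add.
by apply: compb_ltn => //; apply: compW ci.
Qed.

Lemma comp_table d m (P : state -> pred nat) : bounded m -> comp d m -> compb_under d P ->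
  comp d (fun s => table (m s) (P s)).
Proof.
move=> bm cm cP; apply: comp_iteri => //; first by apply: comp_cst; case: cm.
move=> d' J A le cJ cA; apply: comp_if => //; first exact: cP.
by apply: comp_add => //; apply: comp_pow2 => //; apply: compW cm.
Qed.

Lemma compb_bit d m x i : bounded m -> comp d m -> comp d x -> comp d i ->
  compb d (fun s => bit (m s) (x s) (i s)).
Proof.
move=> bm cm cx ci; apply: compb_leq; first exact: comp_pow2.
apply: comp_iteri => // d' J A le cJ cA.
have cm' := compW le cm; have ci' := compW le ci.
have cmJ : comp d' (fun s => m s - (J s).+1) by apply: comp_sub => //; apply: comp_succ.
apply: comp_if => //; last by apply: comp_sub => //; apply: comp_pow2.
apply: compb_and; first exact: compb_ltn.
by apply: compb_leq => //; apply: comp_pow2.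
Qed.

(* In the functions below n is the number of vertices, a state x of the search
   codes two symmetric relations on vertices, and e is the first of them. *)
Definition adjb n x : rel nat := fun u v =>
  [&& u < n, v < n & bit (n * n + n * n) x (u * n + v)].

(** The second half of the code: the added edges whose ends are to get the same colour. *)
Definition sameb n x : rel nat := fun u v =>
  [&& u < n, v < n & bit (n * n + n * n) x (n * n + (u * n + v))].

(** The set [ball] of radius [t], coded as a number. The loop always makes [n] passes and stands
    still from pass [t] on, so its length is bounded whatever [t] is. *)
Definition layer n (e : rel nat) v a b t :=
  iteri n (fun j L =>
      if j < t then
        table n (fun y => bit n L y ||
          ((y == a) || (y != v) && ~~ e v y) && has (fun z => bit n L z && e y z) (iota 0 n))
      else L)
    (table n (fun y => y == b)).

Definition dist n e v a b y := find (fun t => bit n (layer n e v a b t) y) (iota 0 n.+1).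

Definition toward n (e : rel nat) v a b y :=
  find (fun z => bit n (layer n e v a b (dist n e v a b y).-1) z && e y z) (iota 0 n).

Definition along n e v a b d :=
  iteri n (fun j y => if j < d then toward n e v a b y else y) a.

Definition obstruction n (e : rel nat) v a b :=
  [&& e v a, e v b, a != b, ~~ e a b & bit n (layer n e v a b n) a].

(** The default value [n] of [find] signals that there is no obstruction. *)
Definition obs_v n e :=
  find (fun v => has (fun a => has (obstruction n e v a) (iota 0 n)) (iota 0 n)) (iota 0 n).

Definition obs_a n e :=
  find (fun a => has (obstruction n e (obs_v n e) a) (iota 0 n)) (iota 0 n).

Definition obs_b n e := find (obstruction n e (obs_v n e) (obs_a n e)) (iota 0 n).

(** A number [d] names a chord as in [hole_chord]. *)
Definition chord1 n e d := if d == 0 then obs_a n e else obs_v n e.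

Definition chord2 n e d :=
  if d == 0 then obs_b n e else along n e (obs_v n e) (obs_a n e) (obs_b n e) d.

(** A guessed digit may fail to name two distinct non-adjacent vertices, or no obstruction may be
    left; [step] then leaves the state unchanged. *)
Definition chord_ok n (e : rel nat) d :=
  [&& obs_v n e < n, chord1 n e d < n, chord2 n e d < n,
      chord1 n e d != chord2 n e d & ~~ e (chord1 n e d) (chord2 n e d)].

Definition pair_index n u v i := (i == u * n + v) || (i == v * n + u).

(* The digit g < 2 * B chooses a chord and, by g < B, whether its ends are to
   get different colours. *)
Definition step n B x g :=
  let d := if g < B then g else g - B in
  let p := chord1 n (adjb n x) d in
  let q := chord2 n (adjb n x) d in
  if chord_ok n (adjb n x) d then
    table (n * n + n * n) (fun i => [|| bit (n * n + n * n) x i, pair_index n p q i |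
      (B <= g) && ((n * n <= i) && pair_index n p q (i - n * n))])
  else x.

(* x %/ b when x < E; the range of the search must not depend on x *)
Definition quo E b x := find (fun q => x < q.+1 * b) (iota 0 E).

Definition strip K E b w i := iteri K (fun j a => if j < i then quo E b a else a) w.

Definition digit K E b w i := strip K E b w i - quo E b (strip K E b w i) * b.

Definition budget_base K := 4 * K + 1.

Definition run n K E x0 w :=
  let B := budget_base K in
  iteri K (fun i x => step n B x (digit K E (B + B) w i)) x0.

Definition nbr n (e : rel nat) R v u := [&& bit n R u, u != v & e v u].

(** Such a vertex can be eliminated and later coloured greedily: it copies the colour of a neighbour
    that [f] labels equal to it, or its neighbours use fewer than [l] colours. Colours are counted
    through the least vertex of each class of [f] on the neighbours. *)
Definition removable n l (e f : rel nat) R v :=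
  [&& bit n R v,
      all (fun a => all (fun b => [&& nbr n e R v a, nbr n e R v b & a != b] ==> e a b)
                        (iota 0 n)) (iota 0 n) &
      has (fun u => nbr n e R v u && f u v) (iota 0 n) ||
      (count (fun u => nbr n e R v u &&
                all (fun w => nbr n e R v w && (w < u) ==> ~~ f w u) (iota 0 n))
             (iota 0 n) < l)].

(** When nothing is removable, [find] returns [n] and the set no longer changes. *)
Definition remaining n l (e f : rel nat) :=
  iteri n (fun _ R =>
      table n (fun y => bit n R y && (y != find (removable n l e f R) (iota 0 n))))
    (table n xpredT).

Definition eliminable n l e f := all (fun y => ~~ bit n (remaining n l e f) y) (iota 0 n).

(** Tested at run time, which frees the soundness proof from any invariant of the search. *)
Definition consistent n (inp : nat -> nat) (e f : rel nat) :=
  all (fun u => all (fun v =>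
    [&& (inp (u * n + v) != 0) ==> e u v && ~~ f u v, e u v ==> e v u, f u v ==> f v u &
        all (fun w => [&& e u v, e v w, e u w, f u v & f v w] ==> f u w) (iota 0 n)])
    (iota 0 n)) (iota 0 n).

Definition input_state n (inp : nat -> nat) :=
  table (n * n + n * n) (fun i => (i < n * n) && (inp i != 0)).

(** With [n.+1] colours the colour count never fails, so this tests only for a perfect elimination
    ordering. *)
Definition reaches n K E inp w :=
  let x := run n K E (input_state n inp) w in eliminable n n.+1 (adjb n x) (sameb n x).

Definition certifies n l K E inp w :=
  let x := run n K E (input_state n inp) w in
  eliminable n l (adjb n x) (sameb n x) && consistent n inp (adjb n x) (sameb n x).

Definition search_size K :=
  iteri K (fun _ E => E * (budget_base K + budget_base K)) 1.

(** * Computability of the search, one function at a time *)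

Lemma bounded_reg i : (i == 0) || (i == 2) || (i == 3) -> bounded (fun s => reg s i).
Proof.
move=> Hi; exists id; first exact: poly_bounded_id.
by case/orP: Hi => [/orP[]|] /eqP -> s; rewrite /weight; lia.
Qed.

Ltac bounded_tac :=
  lazymatch goal with
  | |- bounded (fun s => reg s _) => by apply: bounded_reg
  | |- bounded (fun s => _ + _) => apply: bounded_add; bounded_tac
  | |- bounded (fun s => _ * _) => apply: bounded_mul; bounded_tac
  | |- bounded (fun s => _.+1) => apply: bounded_succ; bounded_tac
  | |- bounded _ => first [assumption | exact: bounded_cst]
  end.

Ltac gt3_tac :=
  try assumption; match goal with H : comp _ _ |- _ => by move: (comp_gt3 H); lia end.

Ltac leaf_tac :=
  match goal with
  | H : comp _ ?F |- comp _ ?F => apply: compW H; lia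
  | H : comp _ ?F |- comp _ (fun s => ?F s) => apply: compW H; lia
  end.

Ltac known_tac := fail.

Ltac comp_tac :=
  try (move=> ? ? ? ?);
  lazymatch goal with
  | |- bounded _ => bounded_tac
  | |- is_true (3 < _) => gt3_tac
  | |- compb _ (fun s => ~~ _) => apply: compb_not; comp_tac
  | |- compb _ (fun s => _ && _) => apply: compb_and; comp_tac
  | |- compb _ (fun s => _ || _) => apply: compb_or; comp_tac
  | |- compb _ (fun s => _ ==> _) => apply: compb_imply; comp_tac
  | |- compb _ (fun s => _ == _) => apply: compb_eq; comp_tac
  | |- compb _ (fun s => leq (S _) _) => apply: compb_ltn; comp_tac
  | |- compb _ (fun s => leq _ _) => apply: compb_leq; comp_tac
  | |- compb _ (fun s => bit _ _ _) => apply: compb_bit; comp_tac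
  | |- compb _ (fun s => has _ _) => apply: compb_has; comp_tac
  | |- compb _ (fun s => all _ _) => apply: compb_all; comp_tac
  | |- comp _ (fun s => if _ then _ else _) => apply: comp_if; comp_tac
  | |- comp _ (fun s => find _ _) => apply: comp_find; comp_tac
  | |- comp _ (fun s => count _ _) => apply: comp_count; comp_tac
  | |- comp _ (fun s => table _ _) => apply: comp_table; comp_tac
  | |- comp _ (fun s => _ + _) => apply: comp_add; comp_tac
  | |- comp _ (fun s => _ - _) => apply: comp_sub; comp_tac
  | |- comp _ (fun s => _ * _) => apply: comp_mul; comp_tac
  | |- comp _ (fun s => _.+1) => apply: comp_succ; comp_tac
  | |- comp _ (fun s => _.-1) => apply: comp_pred; comp_tac
  | |- comp _ (fun s => reg s _) => first [leaf_tac | apply: comp_reg; gt3_tac]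
  | |- comp _ (fun s => iteri _ _ _) => apply: comp_iteri;
      [comp_tac | comp_tac | comp_tac | move=> ? ? ? ? ? ?; comp_tac]
  | |- comp _ (fun s => nat_of_bool (@?P s)) => change (compb _ P); comp_tac
  | |- _ => first [leaf_tac | known_tac; comp_tac | apply: comp_cst; gt3_tac]
  end.

Lemma compb_adjb d x u v : comp d x -> comp d u -> comp d v ->
  compb d (fun s => adjb (reg s 0) (x s) (u s) (v s)).
Proof. by move=> cx cu cv; rewrite /adjb; comp_tac. Qed.

Lemma compb_sameb d x u v : comp d x -> comp d u -> comp d v ->
  compb d (fun s => sameb (reg s 0) (x s) (u s) (v s)).
Proof. by move=> cx cu cv; rewrite /sameb; comp_tac. Qed.

Ltac known_tac ::=
  lazymatch goal with
  | |- compb _ (fun s => adjb _ _ _ _) => apply: compb_adjb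
  | |- compb _ (fun s => sameb _ _ _ _) => apply: compb_sameb
  end.

Lemma comp_layer d x v a b t : comp d x -> comp d v -> comp d a -> comp d b -> comp d t ->
  comp d (fun s => layer (reg s 0) (adjb (reg s 0) (x s)) (v s) (a s) (b s) (t s)).
Proof. by move=> cx cv ca cb ct; rewrite /layer; comp_tac. Qed.

Ltac known_tac ::=
  lazymatch goal with
  | |- compb _ (fun s => adjb _ _ _ _) => apply: compb_adjb
  | |- compb _ (fun s => sameb _ _ _ _) => apply: compb_sameb
  | |- comp _ (fun s => layer _ _ _ _ _ _) => apply: comp_layer
  end.

Lemma comp_dist d x v a b y : comp d x -> comp d v -> comp d a -> comp d b -> comp d y ->
  comp d (fun s => dist (reg s 0) (adjb (reg s 0) (x s)) (v s) (a s) (b s) (y s)).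
Proof. by move=> cx cv ca cb cy; rewrite /dist; comp_tac. Qed.

Ltac known_tac ::=
  lazymatch goal with
  | |- compb _ (fun s => adjb _ _ _ _) => apply: compb_adjb
  | |- comp _ (fun s => layer _ _ _ _ _ _) => apply: comp_layer
  | |- comp _ (fun s => dist _ _ _ _ _ _) => apply: comp_dist
  end.

Lemma comp_toward d x v a b y : comp d x -> comp d v -> comp d a -> comp d b -> comp d y ->
  comp d (fun s => toward (reg s 0) (adjb (reg s 0) (x s)) (v s) (a s) (b s) (y s)).
Proof. by move=> cx cv ca cb cy; rewrite /toward; comp_tac. Qed.

Lemma comp_along d x v a b i : comp d x -> comp d v -> comp d a -> comp d b -> comp d i ->
  comp d (fun s => along (reg s 0) (adjb (reg s 0) (x s)) (v s) (a s) (b s) (i s)).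
Proof.
move=> cx cv ca cb ci; rewrite /along; apply: comp_iteri => //; [bounded_tac | comp_tac |].
by move=> d' J A le cJ cA; apply: comp_if; [comp_tac | apply: comp_toward; comp_tac | comp_tac].
Qed.

Lemma compb_obstruction d x v a b : comp d x -> comp d v -> comp d a -> comp d b ->
  compb d (fun s => obstruction (reg s 0) (adjb (reg s 0) (x s)) (v s) (a s) (b s)).
Proof. by move=> cx cv ca cb; rewrite /obstruction; comp_tac. Qed.

Ltac known_tac ::=
  lazymatch goal with
  | |- compb _ (fun s => obstruction _ _ _ _ _) => apply: compb_obstruction
  end.

Lemma comp_obs_v d x : comp d x -> comp d (fun s => obs_v (reg s 0) (adjb (reg s 0) (x s))).
Proof. by move=> cx; rewrite /obs_v; comp_tac. Qed.

Lemma comp_obs_a d x : comp d x -> comp d (fun s => obs_a (reg s 0) (adjb (reg s 0) (x s))).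
Proof. by move=> cx; have cv := comp_obs_v cx; rewrite /obs_a; comp_tac. Qed.

Lemma comp_obs_b d x : comp d x -> comp d (fun s => obs_b (reg s 0) (adjb (reg s 0) (x s))).
Proof.
by move=> cx; have cv := comp_obs_v cx; have ca := comp_obs_a cx; rewrite /obs_b; comp_tac.
Qed.

Ltac known_tac ::=
  lazymatch goal with
  | |- comp _ (fun s => obs_v _ _) => apply: comp_obs_v
  | |- comp _ (fun s => obs_a _ _) => apply: comp_obs_a
  | |- comp _ (fun s => obs_b _ _) => apply: comp_obs_b
  | |- comp _ (fun s => along _ _ _ _ _ _) => apply: comp_along
  end.

Lemma comp_chord1 d x i : comp d x -> comp d i ->
  comp d (fun s => chord1 (reg s 0) (adjb (reg s 0) (x s)) (i s)).
Proof. by move=> cx ci; rewrite /chord1; comp_tac. Qed.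

Lemma comp_chord2 d x i : comp d x -> comp d i ->
  comp d (fun s => chord2 (reg s 0) (adjb (reg s 0) (x s)) (i s)).
Proof. by move=> cx ci; rewrite /chord2; comp_tac. Qed.

Ltac known_tac ::=
  lazymatch goal with
  | |- compb _ (fun s => adjb _ _ _ _) => apply: compb_adjb
  | |- comp _ (fun s => obs_v _ _) => apply: comp_obs_v
  | |- comp _ (fun s => chord1 _ _ _) => apply: comp_chord1
  | |- comp _ (fun s => chord2 _ _ _) => apply: comp_chord2
  end.

Lemma compb_chord_ok d x i : comp d x -> comp d i ->
  compb d (fun s => chord_ok (reg s 0) (adjb (reg s 0) (x s)) (i s)).
Proof. by move=> cx ci; rewrite /chord_ok; comp_tac. Qed.

Lemma comp_step d B x g : comp d B -> comp d x -> comp d g ->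
  comp d (fun s => step (reg s 0) (B s) (x s) (g s)).
Proof.
move=> cB cx cg; rewrite /step /pair_index.
have ci : comp d (fun s => if g s < B s then g s else g s - B s) by comp_tac.
have c1 := comp_chord1 cx ci; have c2 := comp_chord2 cx ci.
by apply: comp_if; [exact: compb_chord_ok | comp_tac | comp_tac].
Qed.

Lemma comp_quo d E b x : bounded E -> bounded b -> comp d E -> comp d b -> comp d x ->
  comp d (fun s => quo (E s) (b s) (x s)).
Proof.
move=> bE bb cE cb cx; rewrite /quo; apply: comp_find => // d' J le cJ.
by apply: compb_ltn; [| apply: comp_mul]; comp_tac.
Qed.

Lemma comp_strip d b w i : bounded b -> comp d b -> comp d w -> comp d i ->
  comp d (fun s => strip (reg s 2) (reg s 3) (b s) (w s) (i s)).
Proof.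
move=> bb cb cw ci; rewrite /strip; apply: comp_iteri => //; [bounded_tac | comp_tac |].
move=> d' J A le cJ cA; apply: comp_if; [comp_tac | | comp_tac].
by apply: comp_quo => //; comp_tac.
Qed.

Lemma comp_digit d b w i : bounded b -> comp d b -> comp d w -> comp d i ->
  comp d (fun s => digit (reg s 2) (reg s 3) (b s) (w s) (i s)).
Proof.
move=> bb cb cw ci; have cs := comp_strip bb cb cw ci; apply: comp_sub => //.
by apply: comp_mul => //; apply: comp_quo => //; comp_tac.
Qed.

Lemma comp_run d x0 w : comp d x0 -> comp d w ->
  comp d (fun s => run (reg s 0) (reg s 2) (reg s 3) (x0 s) (w s)).
Proof.
move=> cx cw; rewrite /run /budget_base; apply: comp_iteri => //; [bounded_tac | comp_tac |].
move=> d' J A le cJ cA; apply: comp_step => //; [comp_tac |].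
by apply: comp_digit; comp_tac.
Qed.

Ltac known_tac ::=
  lazymatch goal with
  | |- compb _ (fun s => adjb _ _ _ _) => apply: compb_adjb
  | |- compb _ (fun s => sameb _ _ _ _) => apply: compb_sameb
  | |- comp _ (fun s => Defs.mem s _) => apply: comp_mem
  end.

Lemma compb_removable d l x R v : comp d l -> comp d x -> comp d R -> comp d v ->
  compb d (fun s => removable (reg s 0) (l s) (adjb (reg s 0) (x s))
                      (sameb (reg s 0) (x s)) (R s) (v s)).
Proof. by move=> cl cx cR cv; rewrite /removable /nbr; comp_tac. Qed.

Lemma comp_input_state d : 3 < d -> comp d (fun s => input_state (reg s 0) (Defs.mem s)).
Proof.
by move=> lt3; have c0 := comp_reg lt3 (ltnW (ltnW (ltnW lt3))); rewrite /input_state; comp_tac.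
Qed.

Lemma compb_consistent d x : comp d x ->
  compb d (fun s => consistent (reg s 0) (Defs.mem s) (adjb (reg s 0) (x s))
                      (sameb (reg s 0) (x s))).
Proof. by move=> cx; rewrite /consistent; comp_tac. Qed.

Ltac known_tac ::=
  lazymatch goal with
  | |- compb _ (fun s => removable _ _ _ _ _ _) => apply: compb_removable
  end.

Lemma comp_remaining d l x : comp d l -> comp d x ->
  comp d (fun s => remaining (reg s 0) (l s) (adjb (reg s 0) (x s)) (sameb (reg s 0) (x s))).
Proof. by move=> cl cx; rewrite /remaining; comp_tac. Qed.

Ltac known_tac ::=
  lazymatch goal with
  | |- comp _ (fun s => remaining _ _ _ _) => apply: comp_remaining
  end.

Lemma compb_eliminable d l x : comp d l -> comp d x ->
  compb d (fun s => eliminable (reg s 0) (l s) (adjb (reg s 0) (x s)) (sameb (reg s 0) (x s))).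
Proof. by move=> cl cx; rewrite /eliminable; comp_tac. Qed.

Lemma compb_reaches d w : comp d w ->
  compb d (fun s => reaches (reg s 0) (reg s 2) (reg s 3) (Defs.mem s) (w s)).
Proof.
move=> cw; have lt3 := comp_gt3 cw; have cx := comp_run (comp_input_state lt3) cw.
by apply: compb_eliminable => //; comp_tac.
Qed.

Lemma compb_certifies d w : comp d w ->
  compb d (fun s => certifies (reg s 0) (reg s 1) (reg s 2) (reg s 3) (Defs.mem s) (w s)).
Proof.
move=> cw; have lt3 := comp_gt3 cw; have cx := comp_run (comp_input_state lt3) cw.
apply: compb_and; last exact: compb_consistent.
by apply: compb_eliminable => //; comp_tac.
Qed.

Lemma comp_search_size : comp 5 (fun s => search_size (reg s 2)).
Proof.
rewrite /search_size /budget_base; have c2 : comp 5 (fun s => reg s 2) by apply: comp_reg.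
by comp_tac.
Qed.

Lemma compb_some_reaches : compb 5 (fun s =>
  has (reaches (reg s 0) (reg s 2) (reg s 3) (Defs.mem s)) (iota 0 (reg s 3))).
Proof.
apply: compb_has; [bounded_tac | exact: comp_reg |].
by move=> d' J le cJ; apply: compb_reaches.
Qed.

Lemma compb_some_certifies : compb 5 (fun s =>
  has (certifies (reg s 0) (reg s 1) (reg s 2) (reg s 3) (Defs.mem s)) (iota 0 (reg s 3))).
Proof.
apply: compb_has; [bounded_tac | exact: comp_reg |].
by move=> d' J le cJ; apply: compb_certifies.
Qed.

(** * Correctness *)

Lemma iteri_prefix (X : Type) n d (f : X -> X) x :
  iteri n (fun j y => if j < d then f y else y) x = iter (minn d n) f x.
Proof.
elim: n => [|n /= ->]; first by rewrite minn0.
case: ifP => h; last by congr (iter _ f x); lia.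
by rewrite -iterS; congr (iter _ f x); lia.
Qed.

Lemma foldl_iteri (X : Type) (Y : Type) (f : X -> Y -> X) K (g : nat -> Y) x :
  iteri K (fun i x => f x (g i)) x = foldl f x (map g (iota 0 K)).
Proof.
by elim: K => // K IH; rewrite -[in RHS]addn1 iotaD map_cat foldl_cat /= -IH.
Qed.

Lemma quoE E b x : 0 < b -> x < E -> quo E b x = x %/ b.
Proof.
move=> b0 lt; rewrite /quo; have ltq : x %/ b < E by apply: leq_ltn_trans (leq_div _ _) lt.
apply/eqP; rewrite eqn_leq; apply/andP; split.
  rewrite leqNgt; apply/negP => ltf.
  have := before_find 0 ltf; rewrite nth_iota // add0n.
  by rewrite -ltn_divLR // ltnS leqnn.
rewrite leqNgt; apply/negP => ltf.
set k := find _ _ in ltf.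
have lk : k < E by apply: ltn_trans ltf ltq.
have hk : has (fun q => x < q.+1 * b) (iota 0 E) by rewrite has_find size_iota.
have := nth_find 0 hk; rewrite -/k nth_iota // add0n -ltn_divLR // ltnS.
by rewrite leqNgt ltf.
Qed.

Lemma stripE K E b w i : 0 < b -> w < E -> i <= K -> strip K E b w i = iter i (fun a => a %/ b) w.
Proof.
move=> b0 lt le; rewrite /strip iteri_prefix (minn_idPl le).
have: iter i (quo E b) w = iter i (fun a => a %/ b) w /\ iter i (fun a => a %/ b) w < E.
  elim: {le}i => [|i [IH ltE]] //=; rewrite IH quoE //; split=> //.
  by apply: leq_ltn_trans (leq_div _ _) ltE.
by case.
Qed.

Lemma digitE K E b w i : 0 < b -> w < E -> i <= K ->
  digit K E b w i = iter i (fun a => a %/ b) w %% b.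
Proof.
move=> b0 lt le; rewrite /digit stripE // quoE //; last first.
  by elim: {le} i => //= i IH; apply: leq_ltn_trans (leq_div _ _) IH.
by set x := iter i _ w; rewrite {1}(divn_eq x b) addKn.
Qed.

Lemma search_sizeE K : search_size K = (budget_base K + budget_base K) ^ K.
Proof.
rewrite /search_size; move: (_ + _) => b; elim: K => //= m ->.
by rewrite expnSr.
Qed.

Lemma digits_exist b gs : 0 < b -> all (fun g => g < b) gs ->
  exists2 w, w < b ^ size gs & forall i, i < size gs ->
    iter i (fun a => a %/ b) w %% b = nth 0 gs i.
Proof.
move=> b0; elim: gs => [|g gs IH] /=; first by exists 0; rewrite ?expn0.
case/andP=> ltg /IH[w ltw digs]; exists (w * b + g).
  by rewrite expnS mulnC; nia.
case=> [|i] lti; first by rewrite /= modnMDl modn_small.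
by rewrite iterSr divnMDl // divn_small // addn0 digs.
Qed.

Definition digits K w :=
  let b := budget_base K + budget_base K in
  [seq iter i (fun a => a %/ b) w %% b | i <- iota 0 K].

Lemma runE n K x0 w : w < search_size K ->
  run n K (search_size K) x0 w = foldl (step n (budget_base K)) x0 (digits K w).
Proof.
move=> lt; rewrite /run foldl_iteri; congr (foldl _ _ _).
apply/eq_in_map => i; rewrite mem_iota => /andP[_ lti].
by rewrite digitE // ?(ltnW lti) // /budget_base; lia.
Qed.

Lemma digits_lt K w : all (fun g => g < budget_base K + budget_base K) (digits K w).
Proof.
by apply/allP => _ /mapP[i _ ->]; rewrite ltn_mod /budget_base; lia.
Qed.

(** Hence running through all [w] below [search_size K] tries every sequence of [K] guesses. *)
Lemma digits_surj K gs : size gs = K ->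
  all (fun g => g < budget_base K + budget_base K) gs ->
  exists2 w, w < search_size K & digits K w = gs.
Proof.
move=> szg /digits_exist[|w]; first by rewrite /budget_base; lia.
rewrite szg -search_sizeE => ltw digs; exists w => //.
apply: (@eq_from_nth _ 0); first by rewrite size_map size_iota.
by move=> i; rewrite size_map size_iota => lti; rewrite (nth_map 0) ?size_iota // nth_iota // digs.
Qed.

Definition add_pair (e : rel nat) p q : rel nat :=
  fun u v => e u v || ((u == p) && (v == q) || (u == q) && (v == p)).

(** The effect of a guess on the graph alone. It ignores the label, so the same chords can be
    replayed with other labels. *)
Definition add_chord n e d :=
  if chord_ok n e d then add_pair e (chord1 n e d) (chord2 n e d) else e.

Lemma cell_lt n u v : u < n -> v < n -> u * n + v < n * n.
Proof. nia. Qed.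

Lemma cell_inj n u v p q : v < n -> q < n ->
  (u * n + v == p * n + q) = (u == p) && (v == q).
Proof.
move=> ltv ltq; apply/eqP/andP => [eqc|[/eqP -> /eqP ->]] //.
have n0 : 0 < n by lia.
have := congr1 (divn ^~ n) eqc; rewrite /= !divnMDl // !divn_small // !addn0 => equ.
by split; [rewrite equ | move/eqP: eqc; rewrite equ eqn_add2l].
Qed.

Definition choice_of B g := if g < B then g else g - B.

Lemma adjb_step n B x g :
  adjb n (step n B x g) =2 add_chord n (adjb n x) (choice_of B g).
Proof.
move=> u v; rewrite /add_chord /step -/(choice_of B g).
set d := choice_of B g; case ok : chord_ok => //.
case/and5P: ok => _ ltp ltq _ _; rewrite {1}/adjb /add_pair.
set p := chord1 _ _ _ in ltp *; set q := chord2 _ _ _ in ltq *.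
have notin w r : ~~ (w < n) -> r < n -> (w == r) = false.
  by move=> gew ltr; apply: contraNF gew => /eqP ->.
have [ltu|] := ltnP u n; last first.
  rewrite leqNgt => ltu; rewrite /adjb (negPf ltu) /=.
  by rewrite !(notin u).
have [ltv|] := ltnP v n; last first.
  rewrite leqNgt => ltv; rewrite /adjb (negPf ltv) /= !andbF /=.
  by rewrite !(notin v) ?andbF.
have ltc := cell_lt ltu ltv.
rewrite bit_table /adjb ltu ltv /= /pair_index !cell_inj // (leqNgt (n * n)) ltc andbF orbF.
by rewrite (leq_trans ltc) ?leq_addr.
Qed.

Lemma sameb_step n B x g u v : chord_ok n (adjb n x) (choice_of B g) ->
  sameb n (step n B x g) u v =
  sameb n x u v || (B <= g) &&
    ((u == chord1 n (adjb n x) (choice_of B g)) && (v == chord2 n (adjb n x) (choice_of B g)) ||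
     (u == chord2 n (adjb n x) (choice_of B g)) && (v == chord1 n (adjb n x) (choice_of B g))).
Proof.
move=> ok; rewrite {1}/sameb /step -/(choice_of B g) ok; set d := choice_of B g in ok *.
case/and5P: ok => _ ltp ltq _ _.
set p := chord1 _ _ _ in ltp *; set q := chord2 _ _ _ in ltq *.
have notin w r : ~~ (w < n) -> r < n -> (w == r) = false.
  by move=> gew ltr; apply: contraNF gew => /eqP ->.
have [ltu|] := ltnP u n; last first.
  rewrite leqNgt => ltu; rewrite /sameb (negPf ltu) /=.
  by rewrite !(notin u) ?andbF.
have [ltv|] := ltnP v n; last first.
  rewrite leqNgt => ltv; rewrite /sameb (negPf ltv) /= !andbF /=.
  by rewrite !(notin v) ?andbF.
have ltc := cell_lt ltu ltv; have ltpq := cell_lt ltp ltq; have ltqp := cell_lt ltq ltp.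
rewrite bit_table /sameb ltu ltv /= ltn_add2l ltc leq_addr addKn /=.
have -> : pair_index n p q (n * n + (u * n + v)) = false by rewrite /pair_index; lia.
by rewrite /= /pair_index !cell_inj.
Qed.

Lemma input_state_adjb n inp u v :
  adjb n (input_state n inp) u v = [&& u < n, v < n & inp (u * n + v) != 0].
Proof.
rewrite /adjb; case: (ltnP u n) => //= ltu; case: (ltnP v n) => //= ltv.
by have ltc := cell_lt ltu ltv; rewrite bit_table ltc (leq_trans ltc) ?leq_addr.
Qed.

Lemma input_state_sameb n inp u v : sameb n (input_state n inp) u v = false.
Proof.
by rewrite /sameb bit_table [_ < n * n]ltnNge leq_addr /= !andbF.
Qed.

Lemma allIP n (p : pred nat) : reflect (forall u, u < n -> p u) (all p (iota 0 n)).
Proof.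
apply: (iffP allP) => [H u ltu|H u]; first by apply: H; rewrite mem_iota.
by rewrite mem_iota => /andP[_ ltu]; apply: H.
Qed.

Lemma hasIP n (p : pred nat) : reflect (exists2 u, u < n & p u) (has p (iota 0 n)).
Proof.
apply: (iffP hasP) => [[u]|[u ltu pu]]; last by exists u; rewrite ?mem_iota.
by rewrite mem_iota => /andP[_ ltu]; exists u.
Qed.

Lemma find_iotaP n (p : pred nat) : find p (iota 0 n) < n -> p (find p (iota 0 n)).
Proof.
move=> lt; have := lt; rewrite -{2}(size_iota 0 n) -has_find => /(nth_find 0).
by rewrite nth_iota.
Qed.

Lemma find_iota_lt n (p : pred nat) u : u < n -> p u -> find p (iota 0 n) < n.
Proof.
by move=> ltu pu; rewrite -{2}(size_iota 0 n) -has_find; apply/hasIP; exists u.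
Qed.

Lemma find_iota_min n (p : pred nat) u : u < find p (iota 0 n) -> p u = false.
Proof.
move=> lt; have le := find_size p (iota 0 n); rewrite size_iota in le.
by have := before_find 0 lt; rewrite nth_iota // (leq_trans lt).
Qed.

Lemma removableP n l (e f : rel nat) R v :
  reflect [/\ bit n R v,
     forall a b, a < n -> b < n -> nbr n e R v a -> nbr n e R v b -> a != b -> e a b &
     (exists2 u, u < n & nbr n e R v u && f u v) \/
     size [seq u <- iota 0 n | nbr n e R v u &&
       all (fun w => nbr n e R v w && (w < u) ==> ~~ f w u) (iota 0 n)] < l]
   (removable n l e f R v).
Proof.
apply: (iffP and3P) => [[Rv /allIP cl cols]|[Rv cl cols]]; split=> //.
- move=> a b lta ltb na nb neab; have /allIP/(_ b ltb) := cl a lta.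
  by rewrite na nb neab.
- by case/orP: cols => [/hasIP|]; [left | rewrite -size_filter; right].
- apply/allIP => a lta; apply/allIP => b ltb; apply/implyP => /and3P[na nb ne].
  exact: cl.
- by apply/orP; case: cols => [/hasIP ->|]; [left | rewrite size_filter; right].
Qed.

(* The colourings that the labels f prescribe on the pairs in e *)
Definition colours n l (e f : rel nat) (R : pred nat) (c : nat -> nat) : Prop :=
  (forall u, u < n -> R u -> c u < l) /\
  (forall u w, u < n -> w < n -> R u -> R w -> u != w -> e u w -> (c u == c w) = f u w).

(** On the remaining neighbours of [v], a clique, [c] agrees with [f]. If [f] labels one of them
    equal to [v], its colour suits [v], and transitivity of [f] on triangles gives agreement with
    all the others. Otherwise the representatives number less than [l], so some colour is free. *)
Lemma colours_extend n l (e f : rel nat) R v c :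
  symmetric e -> symmetric f ->
  (forall u w z, u < n -> w < n -> z < n -> e u w -> e w z -> e u z ->
     f u w -> f w z -> f u z) ->
  v < n -> removable n l e f R v ->
  colours n l e f (fun y => bit n R y && (y != v)) c ->
  exists c', colours n l e f (bit n R) c'.
Proof.
move=> se sf tf ltv /removableP[Rv cl cols] [cl_l ce].
have N u : bit n R u -> u != v -> e v u -> nbr n e R v u by move=> ? ? ?; apply/and3P.
suff [k ltk kP] : exists2 k, k < l & forall u, u < n -> nbr n e R v u -> (k == c u) = f v u.
  exists (fun y => if y == v then k else c y); split=> [u ltu Ru|u w ltu ltw Ru Rw ne euw].
    by case: eqVneq => // neu; apply: cl_l => //; rewrite Ru.
  case: (eqVneq u v) => [equ|neu].
    rewrite equ in ne euw *; rewrite [w == v]eq_sym (negPf ne) -kP //.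
    by apply: N; rewrite // eq_sym.
  case: (eqVneq w v) => [eqw|new].
    by rewrite eqw in euw *; rewrite eq_sym sf kP // N // se.
  by apply: ce; rewrite ?Ru ?Rw.
have uv u w : u < n -> w < n -> nbr n e R v u -> nbr n e R v w -> u != w -> (c u == c w) = f u w.
  move=> ltu ltw nu nw ne; have euw := cl u w ltu ltw nu nw ne.
  by case/and3P: nu nw => Ru neu _ /and3P[Rw new _]; apply: ce; rewrite ?Ru ?Rw.
case: (boolP (has (fun u => nbr n e R v u && f u v) (iota 0 n))) => [/hasIP|nosame].
  move=> [u ltu /andP[nu fuv]]; exists (c u) => [|w ltw nw].
    by case/and3P: nu => Ru neu _; apply: cl_l; rewrite ?Ru.
  have fvu : f v u by rewrite sf.
  have evu : e v u by case/and3P: nu.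
  have evw : e v w by case/and3P: nw.
  have [<-|neuw] := eqVneq u w; first by rewrite eqxx fvu.
  have euw : e u w by apply: cl.
  rewrite uv //; apply/idP/idP => [fuw|fvw].
    exact: (tf v u w).
  by apply: (tf u v w) => //; rewrite se.
have {cols} [|reps] := cols; first by case=> u ltu ?; case/hasIP: nosame; exists u.
set reps_v := [seq _ <- _ | _] in reps.
have [k ltk kfree] : exists2 k, k < l & forall u, u < n -> nbr n e R v u -> c u != k.
  have [/hasIP[k ltk /allIP kfree]|] := boolP (has (fun k =>
      all (fun u => nbr n e R v u ==> (c u != k)) (iota 0 n)) (iota 0 l)).
    by exists k => // u ltu nu; have := kfree u ltu; rewrite nu.
  (* If all [l] colours occurred, the least neighbour of each colour would be a representative. *)
  move/hasPn => used; suff: l <= size reps_v by rewrite leqNgt reps.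
  rewrite -{1}(size_iota 0 l) -(size_map c reps_v).
  apply: (uniq_leq_size (iota_uniq 0 l)) => k /used /allPn[u0 u0n].
  rewrite negb_imply negbK => /andP[nu0 /eqP cu0].
  have ex : exists u, [&& u < n, nbr n e R v u & c u == k].
    by exists u0; rewrite nu0 cu0 eqxx; move: u0n; rewrite mem_iota => /andP[_ ->].
  case: (ex_minnP ex) => u /and3P[ltu nu /eqP cu] minu; apply/mapP; exists u => //.
  rewrite mem_filter mem_iota ltu nu /= andbT; apply/allIP => w ltw.
  apply/implyP => /andP[nw ltwu]; apply/negP => fwu.
  have : u <= w by apply: minu; rewrite ltw nw -cu uv //; lia.
  by rewrite leqNgt ltwu.
exists k => // u ltu nu; rewrite eq_sym (negPf (kfree u ltu nu)).
by apply/esym; apply: contraNF nosame => fvu; apply/hasIP; exists u; rewrite // nu sf.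
Qed.

Definition remaining_after n l (e f : rel nat) i :=
  iteri i (fun _ R =>
      table n (fun y => bit n R y && (y != find (removable n l e f R) (iota 0 n))))
    (table n xpredT).

(** The vertices are coloured in the reverse order of their elimination; a round that removed
    nothing leaves the colouring as it is. *)
Lemma eliminable_colours n l (e f : rel nat) :
  symmetric e -> symmetric f ->
  (forall u w z, u < n -> w < n -> z < n -> e u w -> e w z -> e u z ->
     f u w -> f w z -> f u z) ->
  eliminable n l e f -> exists c, colours n l e f xpredT c.
Proof.
move=> se sf tf /allIP empty.
suff back i : exists c, colours n l e f (bit n (remaining_after n l e f (n - i))) c.
  have [c [cl ce]] := back n; exists c; rewrite subnn in cl ce.
  split=> [u ltu _|u w ltu ltw _ _]; first by apply: cl; rewrite // bit_table ltu.
  by apply: ce; rewrite // bit_table ?ltu ?ltw.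
elim: i => [|i [c cP]].
  exists (fun=> 0); split=> [u ltu|u w ltu ltw]; rewrite subn0.
    by rewrite (negPf (empty u ltu)).
  by rewrite (negPf (empty u ltu)).
have [ltin|lein] := ltnP i n; last by exists c; move: cP; have -> : n - i.+1 = n - i by lia.
move: cP; rewrite -(subnSK ltin) /=; set R := remaining_after _ _ _ _ _.
set v := find _ _ => cP; have [ltv|gev] := ltnP v n.
  apply: (@colours_extend n l e f R v c) => //; first exact: find_iotaP.
  case: cP => cl ce; split=> [u ltu Ru|u w ltu ltw Ru Rw].
    by apply: cl; rewrite // bit_table ltu.
  by apply: ce; rewrite // bit_table ?ltu ?ltw.
exists c; case: cP => cl ce.
have same u : u < n -> bit n R u -> bit n (table n (fun y => bit n R y && (y != v))) u.
  by move=> ltu Ru; rewrite bit_table ltu Ru /=; lia.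
split=> [u ltu Ru|u w ltu ltw Ru Rw]; first by apply: cl => //; apply: same.
by apply: ce => //; apply: same.
Qed.

Lemma consistentP n inp (e f : rel nat) :
  reflect [/\ forall u v, u < n -> v < n -> inp (u * n + v) != 0 -> e u v /\ f u v = false,
    forall u v, u < n -> v < n -> e u v -> e v u,
    forall u v, u < n -> v < n -> f u v -> f v u &
    forall u w z, u < n -> w < n -> z < n -> e u w -> e w z -> e u z ->
      f u w -> f w z -> f u z] (consistent n inp e f).
Proof.
apply: (iffP (allIP _ _)) => [H|[Hg He Hf Ht] u ltu].
  have {}H u v (ltu : u < n) (ltv : v < n) := elimT and4P (elimT (allIP _ _) (H u ltu) v ltv).
  split=> [u v ltu ltv g|u v ltu ltv euv|u v ltu ltv fuv|u w z ltu ltw ltz e1 e2 e3 f1 f2].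
  - by have [/implyP/(_ g)/andP[-> /negPf->]] := H u v ltu ltv.
  - by have [_ /implyP/(_ euv)] := H u v ltu ltv.
  - by have [_ _ /implyP/(_ fuv)] := H u v ltu ltv.
  - have [_ _ _ /allIP/(_ z ltz)] := H u w ltu ltw.
    by rewrite e1 e2 e3 f1 f2.
apply/allIP => v ltv; apply/and4P; split.
- by apply/implyP => /(Hg u v ltu ltv)[-> ->].
- by apply/implyP; apply: He.
- by apply/implyP; apply: Hf.
- by apply/allIP => z ltz; apply/implyP => /and5P[? ? ? ? ?]; apply: (Ht u v z).
Qed.

Lemma coloring_inputE n (G : sgraph 'I_n) l (u v : 'I_n) :
  (Defs.mem (coloring_input G l) (u * n + v) != 0) = adj G u v.
Proof.
rewrite /= eqb0 negbK; apply/existsP/idP => [[u' /existsP[v' /andP[/eqP eqc]]]|guv].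
  have /eqP := eqc; rewrite cell_inj // => /andP[/eqP/val_inj -> /eqP/val_inj ->] //.
by exists u; apply/existsP; exists v; rewrite eqxx.
Qed.

Lemma certifies_colorable n (G : sgraph 'I_n) l K E w :
  certifies n l K E (Defs.mem (coloring_input G l)) w -> colorable G l.
Proof.
rewrite /certifies; set x := run _ _ _ _ _; set e := adjb n x; set f := sameb n x.
case/andP=> el /consistentP[Hg He Hf Ht].
have se : symmetric e.
  move=> u v; apply/idP/idP => euv; have /and3P[ltu ltv _] := euv; exact: He.
have sf : symmetric f.
  move=> u v; apply/idP/idP => euv; have /and3P[ltu ltv _] := euv; exact: Hf.
have [c [cl ce]] := eliminable_colours se sf Ht el.
apply/existsP; exists [ffun u : 'I_n => Ordinal (cl u (ltn_ord u) isT)].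
apply/forallP => u; apply/forallP => v; apply/implyP => guv.
rewrite !ffunE -val_eqE /=.
have [euv fuv] : e u v /\ f u v = false.
  by apply: Hg => //; rewrite coloring_inputE.
rewrite (ce u v) // ?fuv //.
by apply: contraTneq guv => /val_inj ->; rewrite adj_irrefl.
Qed.

(** Each round removes a vertex while one is left, so [n] rounds empty the set. *)
Lemma eliminable_of_progress n l (e f : rel nat) :
  (forall R u, u < n -> bit n R u -> exists2 v, v < n & removable n l e f R v) ->
  eliminable n l e f.
Proof.
move=> prog; pose size_of R := count (bit n R) (iota 0 n).
have dec i : i <= n -> size_of (remaining_after n l e f i) <= n - i.
  elim: i => [|i IH] lei.
    by rewrite subn0; apply: leq_trans (count_size _ _) _; rewrite size_iota.
  set R := remaining_after n l e f i in IH *.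
  have -> : remaining_after n l e f i.+1 =
    table n (fun y => bit n R y && (y != find (removable n l e f R) (iota 0 n))) by [].
  set v := find _ _; set R' := table _ _.
  have sub y : y < n -> bit n R' y -> bit n R y.
    by move=> lty; rewrite bit_table lty => /= /andP[].
  case: (boolP (has (bit n R) (iota 0 n))) => [/hasIP[u ltu Ru]|none]; last first.
    suff -> : size_of R' = 0 by [].
    apply/eqP; rewrite -leqn0 leqNgt -has_count; apply: contra none => /hasIP[u ltu /(sub u ltu) Ru].
    by apply/hasIP; exists u.
  have [w ltw Rw] := prog R u ltu Ru.
  have ltv : v < n by apply: find_iota_lt ltw Rw.
  have [Rv _ _] := removableP _ _ _ _ _ _ (find_iotaP ltv).
  have : (size_of R').+1 <= size_of R.
    rewrite /size_of -!size_filter -[X in X <= _]/(size (v :: [seq y <- iota 0 n | bit n R' y])).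
    apply: uniq_leq_size => [|y].
      by rewrite /= filter_uniq ?iota_uniq // mem_filter bit_table -/v eqxx !andbF.
    rewrite in_cons !mem_filter => /predU1P[->|/andP[R'y]]; first by rewrite Rv mem_iota.
    by rewrite mem_iota => /andP[_ lty]; rewrite lty (sub y lty).
  by have := IH (ltnW lei); lia.
apply/allIP => y lty; apply/negP => yR.
have := dec n (leqnn n); rewrite subnn leqNgt -has_count => /negP; apply.
by apply/hasIP; exists y.
Qed.

Definition simplicial_in n (e : rel nat) R v : bool :=
  bit n R v && all (fun a => all (fun b => [&& nbr n e R v a, nbr n e R v b & a != b] ==> e a b)
                        (iota 0 n)) (iota 0 n).

Lemma simplicial_inP n (e : rel nat) R v :
  reflect (bit n R v /\
     forall a b, a < n -> b < n -> nbr n e R v a -> nbr n e R v b -> a != b -> e a b)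
   (simplicial_in n e R v).
Proof.
apply: (iffP andP) => -[Rv cl]; split=> //.
  move=> a b lta ltb na nb neab; have /allIP/(_ a lta)/allIP/(_ b ltb) := cl.
  by rewrite na nb neab.
apply/allIP => a lta; apply/allIP => b ltb; apply/implyP => /and3P[na nb ne].
exact: cl.
Qed.

Lemma removable_all n (e f : rel nat) R v :
  removable n n.+1 e f R v = simplicial_in n e R v.
Proof.
rewrite /removable /simplicial_in; set c := _ || _.
suff -> : c by rewrite andbT.
by apply/orP; right; rewrite ltnS; apply: leq_trans (count_size _ _) _; rewrite size_iota.
Qed.

(** Labels taken from a proper colouring make the colour condition automatic at a simplicial vertex:
    without a neighbour labelled equal to [v], the representatives have pairwise different colours,
    all different from that of [v], so there are fewer than [l] of them. *)
Lemma removable_coloured n l (e f g : rel nat) (c : nat -> nat) R v :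
  (forall u w, u < n -> w < n -> g u w -> c u != c w) -> (forall u, u < n -> c u < l) ->
  (forall u w, u < n -> w < n -> f u w = [&& e u w, ~~ g u w & c u == c w]) ->
  symmetric e -> v < n ->
  removable n l e f R v = simplicial_in n e R v.
Proof.
move=> cg cl fE se ltv; apply/removableP/simplicial_inP => [[]//|[Rv clq]]; split=> //.
case: (boolP (has (fun u => nbr n e R v u && f u v) (iota 0 n))) => [/hasIP|nosame]; first by left.
right; set reps := [seq _ <- _ | _].
have repsP u : u \in reps -> [/\ u < n, nbr n e R v u &
    forall w, w < u -> nbr n e R v w -> ~~ f w u].
  rewrite mem_filter mem_iota => /and3P[/andP[nu /allIP H] _ ltu]; split=> // w ltwu nw.
  by have := H w (ltn_trans ltwu ltu); rewrite nw ltwu.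
have fg u w : u < n -> w < n -> e u w -> c u = c w -> f u w.
  move=> ltu ltw euw eqc; rewrite fE // euw eqc eqxx andbT.
  by apply/negP => /(cg u w ltu ltw); rewrite eqc eqxx.
have cinj : {in reps &, injective c}.
  suff half u w : u \in reps -> w \in reps -> u < w -> c u = c w -> False.
    move=> u w ur wr eqc; case: (ltngtP u w) => // lt.
      by case: (half u w ur wr lt eqc).
    by case: (half w u wr ur lt (esym eqc)).
  move=> /repsP[ltu nu _] /repsP[ltw nw minw] ltuw eqc.
  have /negP := minw u ltuw nu; apply; apply: fg => //; apply: clq => //; lia.
rewrite -(size_map c) -[X in _ <= X](size_iota 0 l).
apply: (@uniq_leq_size _ (c v :: map c reps)) => [|k].
  rewrite /= map_inj_in_uniq // filter_uniq ?iota_uniq // andbT.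
  apply/mapP => -[u /repsP[ltu nu _] eqc].
  case/hasIP: nosame; exists u => //; rewrite nu; apply: fg => //.
  by rewrite se; case/and3P: nu.
rewrite in_cons mem_iota add0n => /predU1P[->|/mapP[u /repsP[ltu _ _] ->]]; exact: cl.
Qed.

Lemma eq_remaining n l l' (e f f' : rel nat) :
  (forall R v, v < n -> removable n l e f R v = removable n l' e f' R v) ->
  remaining n l e f = remaining n l' e f'.
Proof.
move=> eqr; suff eqi i : remaining_after n l e f i = remaining_after n l' e f' i by apply: eqi.
rewrite /remaining_after; elim: i => //= i ->.
congr (table n _); apply: boolp.funext => y; congr (_ && (_ != _)).
by apply: eq_in_find => v; rewrite mem_iota => /andP[_ ltv]; apply: eqr.
Qed.

(** * Obstructions and chords found by the program *)

Section Search.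

Variables (n : nat) (e : rel nat).
Hypotheses (e_sym : symmetric e) (e_irr : irreflexive e).

Let er : rel 'I_n := fun u v => e u v.

Lemma layerE (v a b y : 'I_n) t :
  bit n (layer n e v a b t) y = (y \in ball er v a b (minn t n)).
Proof.
rewrite /layer iteri_prefix; elim: (minn t n) y => [|m IH] y.
  by rewrite /= bit_table ltn_ord inE.
rewrite iterS bit_table ltn_ord IH /= !inE /free; congr (_ || _ && _).
apply/hasIP/existsP => [[z ltz /andP[zm eyz]]|[z /andP[zm eyz]]].
  by exists (Ordinal ltz); rewrite -IH zm.
by exists z; rewrite // IH zm.
Qed.

Lemma obstructionE (v a b : 'I_n) :
  obstruction n e v a b = [&& er v a, er v b, a != b, ~~ er a b & a \in ball er v a b n].
Proof. by rewrite /obstruction layerE minnn. Qed.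

Lemma no_obstruction : n <= obs_v n e -> forall v a b : 'I_n,
  er v a -> er v b -> a != b -> ~~ er a b -> ~~ linked er v a b.
Proof.
move=> none v a b eva evb neab eab; apply/negP => /linked_ball; rewrite card_ord => ab.
suff : obs_v n e < n by rewrite ltnNge none.
apply: (find_iota_lt (ltn_ord v)); apply/hasIP; exists a => //; apply/hasIP; exists b => //.
by rewrite obstructionE eva evb neab eab.
Qed.

(** Dirac's theorem on the remaining vertices, with the empty clique. *)
Lemma simplicial_exists R u : n <= obs_v n e -> u < n -> bit n R u ->
  exists2 v, v < n & simplicial_in n e R v.
Proof.
move=> none ltu Ru; pose U := [set y : 'I_n | bit n R y].
have cl0 : clique er set0 by move=> x y; rewrite inE.
have er_sym : symmetric er by move=> x y; apply: e_sym.
have er_irr : irreflexive er by move=> x; apply: e_irr.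
have [||v [vU _ clv]] := simplicial_outside_clique er_sym er_irr (no_obstruction none)
  (U := U) (u := Ordinal ltu) cl0; rewrite ?inE //.
exists v => //; apply/simplicial_inP; split=> [|a b lta ltb]; first by move: vU; rewrite inE.
move=> /and3P[Ra _ eva] /and3P[Rb _ evb] neab.
by apply: (clv (Ordinal lta) (Ordinal ltb)); rewrite ?inE /= ?Ra ?Rb.
Qed.

Lemma toward_ball (v a b y : 'I_n) m : m < n -> y \in ball er v a b m.+1 ->
  (forall t, t <= m -> y \notin ball er v a b t) ->
  exists2 z : 'I_n, toward n e v a b y = z & (z \in ball er v a b m) && er y z.
Proof.
move=> ltmn ym miny.
have dE : dist n e v a b y = m.+1.
  have ltd : dist n e v a b y < n.+1.
    by apply: (@find_iota_lt n.+1 _ m.+1) => //; rewrite layerE (minn_idPl _).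
  apply/eqP; rewrite eqn_leq; apply/andP; split.
    rewrite leqNgt; apply/negP => /find_iota_min; rewrite layerE (minn_idPl _) ?ym //.
  rewrite ltnNge; apply/negP => led; have := find_iotaP ltd; rewrite -/(dist n e v a b y).
  by rewrite layerE; apply/negP; apply: miny; lia.
have [z zm eyz] := ball_pred ym (miny m (leqnn m)).
have ltt : toward n e v a b y < n.
  by apply: (find_iota_lt (ltn_ord z)); rewrite dE layerE (minn_idPl (ltnW ltmn)) zm.
have [z0 zE] : exists z0 : 'I_n, toward n e v a b y = z0 by exists (Ordinal ltt).
exists z0 => //; have := find_iotaP ltt; rewrite -/(toward n e v a b y) dE zE.
by rewrite layerE (minn_idPl (ltnW ltmn)).
Qed.

Lemma alongE v a b d : along n e v a b d = iter (minn d n) (toward n e v a b) a.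
Proof. exact: iteri_prefix. Qed.

Lemma along_hole (v a b : 'I_n) : obstruction n e v a b ->
  exists D p, hole er v a b D p /\ forall i, i <= D -> along n e v a b i = p i.
Proof.
rewrite obstructionE => /and5P[eva evb neab eab abn].
have er_irr : irreflexive er by move=> x; apply: e_irr.
(* This path only supplies the length [D]; the hole itself is formed by the vertices that [along]
   visits. *)
have [D [q [leDn [_ aD minD _]]]] := geodesic_exists abn.
have walk i : i <= D -> exists y : 'I_n,
    [/\ along n e v a b i = y, y \in ball er v a b (D - i) &
    forall t, t < D - i -> y \notin ball er v a b t].
  elim: i => [|i IH] lei.
    by exists a; rewrite alongE min0n subn0.
  have [y [yE yB miny]] := IH (ltnW lei).
  have fy : free er v a y.
    case/orP: (ball_free yB) => // /eqP yb.
    by have := miny 0; rewrite yb /= inE eqxx => /(_ ltac:(lia)).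
  have DiE : D - i = (D - i.+1).+1 by lia.
  rewrite DiE in yB miny.
  have [||z zE /andP[zB eyz]] := toward_ball _ yB; [lia | by move=> t; apply: miny |].
  exists z; split=> // [|t lt].
    move: yE zE; rewrite !alongE (minn_idPl (ltnW (leq_trans lei leDn))).
    by rewrite (minn_idPl (leq_trans lei leDn)) => yE <-; rewrite -yE.
  by apply: contra (miny t.+1 _) => //; apply: ball_step.
pose p i := insubd a (along n e v a b i).
have pE i (y : 'I_n) : along n e v a b i = y -> p i = y.
  by move=> yE; apply: val_inj; rewrite /p yE val_insubd ltn_ord.
exists D, p; split=> [|i lei]; last by have [y [yE _ _]] := walk i lei; rewrite (pE _ _ yE).
apply: geodesic_hole => //; split=> // [|i lti].
  by have [y [yE _ _]] := walk 0 (leq0n D); apply: pE; rewrite alongE min0n.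
have [y [yE yB miny]] := walk i (ltnW lti); have [z [zE zB _]] := walk i.+1 lti.
rewrite (pE _ _ yE) (pE _ _ zE); split=> //.
have DiE : D - i = (D - i.+1).+1 by lia.
rewrite DiE in yB miny.
have [||z' z'E /andP[_ eyz]] := toward_ball _ yB; [lia | by move=> t; apply: miny |].
suff -> : z = z' by [].
apply: val_inj => /=; rewrite -zE -z'E -yE !alongE.
by rewrite (minn_idPl (leq_trans lti leDn)) (minn_idPl (ltnW (leq_trans lti leDn))).
Qed.

End Search.

Definition ord_rel n (e : rel nat) : rel 'I_n := fun u v => e u v.

Lemma chord_exists n (e : rel nat) (H : sgraph 'I_n) :
  symmetric e -> irreflexive e -> chordal H -> subrel (ord_rel e) (adj H) ->
  obs_v n e < n ->
  exists d (x y : 'I_n), [/\ d <= 4 * #|rel_edges (adj H) :\: rel_edges (ord_rel (n := n) e)|,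
    chord_ok n e d, chord1 n e d = x /\ chord2 n e d = y & adj H x y && ~~ e x y].
Proof.
move=> se ie cH sub ltv; have [v vE] : exists v : 'I_n, obs_v n e = v by exists (Ordinal ltv).
have hv := find_iotaP ltv; rewrite -/(obs_v n e) in hv.
have lta : obs_a n e < n by case/hasIP: hv => a lta ?; apply: find_iota_lt lta _.
have ha := find_iotaP lta; rewrite -/(obs_a n e) in ha.
have [a aE] : exists a : 'I_n, obs_a n e = a by exists (Ordinal lta).
have ltb : obs_b n e < n by case/hasIP: ha => b ltb ?; apply: find_iota_lt ltb _.
have obs := find_iotaP ltb; rewrite -/(obs_b n e) in obs.
have [b bE] : exists b : 'I_n, obs_b n e = b by exists (Ordinal ltb).
rewrite vE aE bE in obs.
have [D [p [hl alongE]]] := along_hole ie obs.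
have neab : ~~ ord_rel e a b by case/and5P: obs.
have ser : symmetric (ord_rel (n := n) e) by move=> x y; apply: se.
have [d [led ltd]] := hole_chord ser cH sub hl neab.
set x := if _ then _ else _; set y := if _ then _ else _ => /andP[Hxy exy].
have xE : chord1 n e d = x by rewrite /chord1 /x aE vE; case: (d == 0).
have yE : chord2 n e d = y.
  by rewrite /chord2 /y aE vE bE; case: (d == 0); rewrite // alongE // ltnW.
exists d, x, y; split=> //; last by rewrite Hxy.
rewrite /chord_ok xE yE ltv !ltn_ord exy andbT /=.
by apply: contraTneq Hxy => /val_inj ->; rewrite adj_irrefl.
Qed.

Lemma add_pair_sym (e : rel nat) p q : symmetric e -> symmetric (add_pair e p q).
Proof.
move=> se u v; rewrite /add_pair se; congr (_ || _).
by rewrite orbC; congr (_ || _); rewrite andbC.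
Qed.

Lemma add_pair_irr (e : rel nat) p q : irreflexive e -> p != q -> irreflexive (add_pair e p q).
Proof.
move=> ie ne u; rewrite /add_pair ie /=; apply/negP => /orP[] /andP[/eqP up /eqP uq].
  by rewrite -up -uq eqxx in ne.
by rewrite -up -uq eqxx in ne.
Qed.

(** Induction on the bound [j] on the number of edges of [H] still missing; each chord chosen is one
    of them. The range of the guesses is fixed by [m], so that it stays the same while [j]
    decreases. *)
Lemma fill_chords_exist n (H : sgraph 'I_n) m j (e : rel nat) :
  chordal H -> symmetric e -> irreflexive e -> subrel (ord_rel e) (adj H) ->
  #|rel_edges (adj H) :\: rel_edges (ord_rel (n := n) e)| <= j -> j <= m ->
  exists ds, [/\ size ds = j, all (fun d => d <= 4 * m) ds &
    let e' := foldl (add_chord n) e ds in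
    [/\ symmetric e', irreflexive e' & n <= obs_v n e']].
Proof.
move=> cH; elim: j e => [|j IH] e se ie sub fill lejm.
  exists [::]; split=> //=; split=> //; rewrite leqNgt; apply/negP => found.
  have [d [x [y [_ _ _ /andP[Hxy exy]]]]] := chord_exists se ie cH sub found.
  have ser : symmetric (ord_rel (n := n) e) by move=> u v; apply: se.
  suff : [set x; y] \in rel_edges (adj H) :\: rel_edges (ord_rel (n := n) e).
    by move: fill; rewrite leqn0 cards_eq0 => /eqP ->; rewrite inE.
  by rewrite inE !mem_rel_edges // ?Hxy ?andbT //; apply: adj_sym.
have [found|none] := ltnP (obs_v n e) n; last first.
  (* No obstruction is left: the sequence is padded with guesses that fail [chord_ok]. *)
  exists (nseq j.+1 0); split; first by rewrite size_nseq.
    by rewrite all_nseq orbT.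
  have -> : foldl (add_chord n) e (nseq j.+1 0) = e.
    elim: (j.+1) => //= i IHi; rewrite /add_chord.
    by rewrite /chord_ok ltnNge none /= IHi.
  by split.
have [d [x [y [led ok [xE yE] /andP[Hxy exy]]]]] := chord_exists se ie cH sub found.
have eE : add_chord n e d = add_pair e x y by rewrite /add_chord ok xE yE.
have nexy : x != y :> nat by case/and5P: ok => _ _ _; rewrite xE yE.
have sub' : subrel (ord_rel (n := n) (add_pair e x y)) (adj H).
  move=> u v /orP[/sub //|/orP[] /andP[/eqP/val_inj -> /eqP/val_inj ->] //].
  by rewrite adj_sym.
have [|||||ds [szds allds]] := IH (add_pair e x y).
- exact: add_pair_sym.
- exact: add_pair_irr.
- exact: sub'.
- have ser : symmetric (ord_rel (n := n) e) by move=> u v; apply: se.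
  have ser' : symmetric (ord_rel (n := n) (add_pair e x y)).
    by move=> u v; apply: add_pair_sym.
  apply: (fill_decrease (x := x) (y := y) ser ser' (@adj_sym _ H) _ Hxy exy _ fill).
    by move=> u v; rewrite /ord_rel /add_pair => ->.
  by rewrite /ord_rel /add_pair !eqxx orbT.
- exact: ltnW.
rewrite -eE => final; exists (d :: ds); split=> //=; first by rewrite szds.
rewrite allds andbT (leq_trans led) // leq_mul2l /=; exact: leq_trans fill lejm.
Qed.

Lemma adjb_foldl n B x gs :
  adjb n (foldl (step n B) x gs) = foldl (add_chord n) (adjb n x) (map (choice_of B) gs).
Proof.
elim: gs x => //= g gs IH x; rewrite IH; congr (foldl _ _ _).
by apply: boolp.funext => u; apply: boolp.funext => v; apply: adjb_step.
Qed.

Lemma eliminable_all n (e f : rel nat) : symmetric e -> irreflexive e ->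
  n <= obs_v n e -> eliminable n n.+1 e f.
Proof.
move=> se ie none; apply: eliminable_of_progress => R u ltu Ru.
have [v ltv sv] := simplicial_exists se ie none ltu Ru.
by exists v; rewrite // removable_all.
Qed.

(** * Completeness of the search on an instance *)

Section Instance.

Variables (n l : nat) (G : sgraph 'I_n).
Let inp := Defs.mem (coloring_input G l).
Let g : rel nat := adjb n (input_state n inp).

Lemma input_rel_ord (u v : 'I_n) : g u v = adj G u v.
Proof. by rewrite /g input_state_adjb !ltn_ord coloring_inputE. Qed.

Lemma input_rel_sym : symmetric g.
Proof.
suff half u v : g u v -> g v u by move=> u v; apply/idP/idP; apply: half.
move=> guv; have /and3P[ltu ltv _] := guv.
by move: guv; rewrite (input_rel_ord (Ordinal ltu) (Ordinal ltv)) adj_sym -input_rel_ord.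
Qed.

Lemma input_rel_irr : irreflexive g.
Proof.
move=> u; apply/negP => guu; have /and3P[ltu _ _] := guu.
by move: guu; rewrite (input_rel_ord (Ordinal ltu) (Ordinal ltu)) adj_irrefl.
Qed.

Lemma chordal_ke_reaches k : chordal_ke k G ->
  has (reaches n k (search_size k) inp) (iota 0 (search_size k)).
Proof.
case=> H [sub fill cH].
have er : rel_edges (ord_rel (n := n) g) = edges G.
  have -> // : ord_rel (n := n) g = adj G.
  by apply: boolp.funext => u; apply: boolp.funext => v; apply: input_rel_ord.
have [||ds [szds allds [se ie none]]] :=
  fill_chords_exist (m := k) cH input_rel_sym input_rel_irr _ _ (leqnn k).
- by move=> u v; rewrite /ord_rel input_rel_ord; apply: sub.
- by rewrite er.
have [|w ltw dE] := digits_surj szds.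
  by apply: sub_all allds => d; rewrite /budget_base; lia.
apply/hasIP; exists w => //; rewrite /reaches runE // dE adjb_foldl.
(* The digits are below [budget_base k], so all chords carry the label for different colours; the
   outcome of [reaches] does not depend on the labels. *)
have -> : map (choice_of (budget_base k)) ds = ds.
  rewrite -[RHS]map_id; apply/eq_in_map => d /(allP allds) led.
  by rewrite /choice_of /budget_base addn1 ltnS led.
exact: eliminable_all.
Qed.

Definition labelled (c : nat -> nat) x : Prop :=
  [/\ symmetric (adjb n x), subrel g (adjb n x) &
    forall u v, sameb n x u v = [&& adjb n x u v, ~~ g u v & c u == c v]].

(** The chord depends on the graph and not on the labels, so each guess can be made by the digit for
    the same chord with the label read off from [c]. *)
Lemma labels_exist c B ds x : labelled c x -> all (fun d => d < B) ds ->
  exists gs, [/\ size gs = size ds, all (fun h => h < B + B) gs &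
    let x' := foldl (step n B) x gs in
    adjb n x' = foldl (add_chord n) (adjb n x) ds /\ labelled c x'].
Proof.
elim: ds x => [|d ds IH] x inv /=; first by exists [::].
case/andP=> ltd allds.
pose p := chord1 n (adjb n x) d; pose q := chord2 n (adjb n x) d.
pose h := if c p == c q then B + d else d.
have hE : choice_of B h = d.
  rewrite /choice_of /h; case: eqP => _; last by rewrite ltd.
  by rewrite ltnNge leq_addr /= addKn.
have hB : (B <= h) = (c p == c q).
  by rewrite /h; case: eqP => _; rewrite ?leq_addr // leqNgt ltd.
have adjS : adjb n (step n B x h) = add_chord n (adjb n x) d.
  by apply: boolp.funext => u; apply: boolp.funext => v; rewrite adjb_step hE.
have inv' : labelled c (step n B x h).
  case: inv => se sub fE; rewrite /labelled adjS /add_chord.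
  case ok : (chord_ok _ _ _); last first.
    split=> // u v; have -> : step n B x h = x by rewrite /step -/(choice_of B h) hE ok.
    exact: fE.
  split; first exact: add_pair_sym.
    by move=> u v /sub euv; rewrite /add_pair euv.
  move=> u v; rewrite sameb_step ?hE // hB fE -/p -/q /add_pair.
  have [_ _ _ _ npq] := and5P ok; rewrite -/p -/q in npq.
  (* An edge of the input cannot be a new chord, so the label of the chord is decided by [c]
     alone. *)
  have ngpq : g p q = false by apply: contraNF npq; apply: sub.
  have ngqp : g q p = false by rewrite input_rel_sym.
  have nqp : adjb n x q p = false by rewrite se; apply: negPf.
  have [/andP[/eqP -> /eqP ->]|other] := boolP ((u == p) && (v == q)).
    by rewrite (negPf npq) ngpq /= andbT.
  have [/andP[/eqP -> /eqP ->]|other'] := boolP ((u == q) && (v == p)).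
    by rewrite nqp ngqp /= andbT eq_sym.
  by rewrite /= andbF !orbF.
have [gs [szgs allgs [adjE invE]]] := IH (step n B x h) inv' allds.
exists (h :: gs); split=> //=; first by rewrite szgs.
  by rewrite allgs andbT /h; case: eqP => _; rewrite ?ltn_add2l // ltn_addl.
by rewrite adjE adjS.
Qed.

(** A successful sequence of guesses is replayed with the labels of the given colouring. The final
    graph is unchanged, and [removable_coloured] shows that the elimination proceeds exactly as
    before. *)
Lemma colorable_certifies K : colorable G l ->
  has (reaches n K (search_size K) inp) (iota 0 (search_size K)) ->
  has (certifies n l K (search_size K) inp) (iota 0 (search_size K)).
Proof.
case/existsP => col /forallP colP /hasIP[w ltw].
pose c u := if insub u is Some i then col i : nat else 0.
have cE (i : 'I_n) : c i = col i by rewrite /c valK.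
have cl u : u < n -> c u < l by move=> ltu; rewrite (cE (Ordinal ltu)).
have cg u v : u < n -> v < n -> g u v -> c u != c v.
  move=> ltu ltv; rewrite (input_rel_ord (Ordinal ltu) (Ordinal ltv)).
  rewrite (cE (Ordinal ltu)) (cE (Ordinal ltv)) val_eqE; apply/implyP.
  by have /forallP := colP (Ordinal ltu); apply.
rewrite /reaches runE // adjb_foldl -/g; set B := budget_base K; set ds := map _ _ => el.
have inv0 : labelled c (input_state n inp).
  split=> //; first exact: input_rel_sym.
  by move=> u v; rewrite input_state_sameb -/g andbA andbN.
have allds : all (fun d => d < B) ds.
  apply/allP => _ /mapP[h /(allP (digits_lt K w)) lth ->]; move: lth; rewrite /choice_of -/B.
  by case: (ltnP h B) => // geB; rewrite ltn_subLR.
have [gs [szgs allgs [adjE [se sub fE]]]] := labels_exist inv0 allds.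
have szK : size gs = K by rewrite szgs !size_map size_iota.
have [w' ltw' dE] := digits_surj szK allgs.
apply/hasIP; exists w' => //; rewrite /certifies runE // dE -/B.
set x := foldl _ _ _ in adjE se sub fE *.
apply/andP; split.
  move: el; rewrite /eliminable -/g -adjE.
  rewrite (@eq_remaining n n.+1 l (adjb n x) _ (sameb n x)) //.
  move=> R v ltv; rewrite removable_all; apply/esym.
  by apply: (removable_coloured (c := c) R cg) => // u z _ _; rewrite fE.
apply/consistentP; split.
- move=> u v ltu ltv guv; have g1 : g u v by rewrite /g input_state_adjb ltu ltv.
  by rewrite fE g1 andbF sub.
- by move=> u v _ _; rewrite se.
- move=> u v _ _; rewrite !fE => /and3P[euv ngv cuv].
  by rewrite se euv input_rel_sym ngv eq_sym.
move=> u y z ltu lty ltz euy eyz euz; rewrite !fE => /and3P[_ _ /eqP c1] /and3P[_ _ /eqP c2].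
rewrite euz c1 c2 eqxx andbT /=; apply/negP => /(cg u z ltu ltz).
by rewrite c1 c2 eqxx.
Qed.

(** This holds at every budget for which the search succeeds, so the machine may stop at the first
    one. *)
Lemma certifiesE K :
  has (reaches n K (search_size K) inp) (iota 0 (search_size K)) ->
  has (certifies n l K (search_size K) inp) (iota 0 (search_size K)) = colorable G l.
Proof.
move=> rK; apply/idP/idP => [/hasIP[w _]|col]; first exact: certifies_colorable.
exact: colorable_certifies.
Qed.

End Instance.

(** * Running time *)

Lemma comp_uniform d F : comp d F -> exists c C g, realizes d c F (fun w => C * w.+1 ^ g).
Proof.
case=> _ _ /(_ d (leqnn d)) [c [T [[C [g le]] R]]]; exists c, C, g => s.
by have [t [s' [E L V W]]] := R s; exists t, s'; rewrite (leq_trans L).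
Qed.

Lemma leq_expl e m n : m <= n -> m ^ e <= n ^ e.
Proof. by case: e => // e le; rewrite leq_exp2r. Qed.

Lemma leq_search_size K k : K <= k -> search_size K <= search_size k.
Proof.
move=> le; rewrite !search_sizeE /budget_base.
apply: (@leq_trans ((4 * k + 1 + (4 * k + 1)) ^ K)); first by apply: leq_expl; lia.
by apply: leq_pexp2l; lia.
Qed.

(** Every budget tried is at most [k], so each pass stays within the bound for [k], and there are at
    most [k.+1] passes. *)
Lemma coloring_program : exists A C g, forall n (G : sgraph 'I_n) l k,
  chordal_ke k G -> exists t s,
    [/\ exec A (coloring_input G l) t s, accepts s = colorable G l &
        t <= C * k.+1 * (n + k + search_size k).+1 ^ g].
Proof.
have [cE [CE [gE RE]]] := comp_uniform comp_search_size.
have [cR [CR [gR RR]]] := comp_uniform compb_some_reaches.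
have [cA [CA [gA RA]]] := comp_uniform compb_some_certifies.
(* Registers 2, 3 and 4 hold the budget, its search size and a flag for failure; 5 receives computed
   values and 6 supplies constants. Adding the flag to the budget leaves a successful budget in
   place on exit. *)
pose body := Seq cE (Seq (Const 6 0) (Seq (Add 3 5 6) (Seq cR
  (Seq (Const 6 1) (Seq (Defs.Sub 4 6 5) (Add 2 2 4)))))).
exists (Seq (Const 2 0) (Seq (Const 4 1) (Seq (While 4 body)
  (Seq cA (Seq (Const 6 0) (Add 0 5 6)))))).
pose C := CE + CR + CA; pose g := gE + gR + gA.
exists (3 * C + 20), g => n G l k ck.
pose W := n + k + search_size k; pose P := C * W.+1 ^ g.
have bound C' g' w : C' <= C -> g' <= g -> w <= W -> C' * w.+1 ^ g' <= P.
  move=> leC leg lew; apply: leq_mul => //.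
  by apply: (@leq_trans (W.+1 ^ g')); [apply: leq_expl | apply: leq_pexp2l].
pose inp := Defs.mem (coloring_input G l).
pose good K := has (reaches n K (search_size K) inp) (iota 0 (search_size K)).
have goodk : good k := chordal_ke_reaches l ck.
have lew s K : reg s 0 = n -> reg s 2 = K -> K <= k -> reg s 3 <= search_size k -> weight s <= W.
  by rewrite /weight => -> ->; rewrite /W; lia.
(* On entry register 3 still holds the search size of the previous pass, or 0 at the start; bounding
   it keeps the weight below [W]. *)
have bodyP s K : reg s 0 = n -> reg s 1 = l -> Defs.mem s = inp -> reg s 2 = K ->
    K <= k -> reg s 3 <= search_size k ->
    exists t s', [/\ exec body s t s', t <= 2 * P + 5,
      [/\ reg s' 0 = n, reg s' 1 = l & Defs.mem s' = inp], reg s' 3 = search_size K &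
      reg s' 4 = ~~ good K /\ reg s' 2 = K + ~~ good K].
  move=> r0 r1 mm r2 leK r3.
  have [t1 [s1 [E1 L1 V1 [A1 M1]]]] := RE s.
  pose s2 := set_reg s1 6 0; pose s3 := set_reg s2 3 (reg s2 5 + reg s2 6).
  have [t4 [s4 [E4 L4 V4 [A4 M4]]]] := RR s3.
  pose s5 := set_reg s4 6 1; pose s6 := set_reg s5 4 (reg s5 6 - reg s5 5).
  pose s7 := set_reg s6 2 (reg s6 2 + reg s6 4).
  have q0 : reg s3 0 = n by rewrite /= A1.
  have q1 : reg s3 1 = l by rewrite /= A1.
  have q2 : reg s3 2 = K by rewrite /= A1.
  have q3 : reg s3 3 = search_size K by rewrite /= V1 addn0 r2.
  have qm : Defs.mem s3 = inp by rewrite /= M1.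
  have {}V4 : reg s4 5 = good K by rewrite V4 q0 q2 q3 qm.
  exists (t1 + (1 + (1 + (t4 + (1 + (1 + 1)))))), s7; split.
  - apply: exec_seq E1 _; apply: exec_seq (exec_const _ _ _) _.
    apply: exec_seq (exec_add _ _ _ _) _; apply: exec_seq E4 _.
    apply: exec_seq (exec_const _ _ _) _; apply: exec_seq (exec_sub _ _ _ _) _.
    exact: exec_add.
  - have le1 : t1 <= P.
      apply: leq_trans L1 (bound _ _ _ _ _ _); rewrite /C /g; [lia..|].
      exact: lew s K r0 r2 leK r3.
    have le4 : t4 <= P.
      apply: leq_trans L4 (bound _ _ _ _ _ _); rewrite /C /g; [lia..|].
      by apply: (lew s3 K); rewrite ?q3 ?leq_search_size.
    by lia.
  - by rewrite /= !A4 // M4.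
  - by rewrite /= A4.
  - by rewrite /= V4 !A4 // q2; case: (good K).
(* Induction on [m = k - K]; at [m = 0] the budget is [k], where the search succeeds. *)
have loop m s K : K + m = k -> reg s 0 = n -> reg s 1 = l -> Defs.mem s = inp ->
    reg s 2 = K -> reg s 3 <= search_size k -> reg s 4 = 1 ->
    exists t s' K', [/\ exec (While 4 body) s t s', good K' /\ K' <= k,
      [/\ reg s' 0 = n, reg s' 1 = l & Defs.mem s' = inp],
      reg s' 2 = K' /\ reg s' 3 = search_size K' & t <= m.+1 * (2 * P + 6) + 1].
  elim: m s K => [|m IH] s K Kk r0 r1 mm r2 r3 r4.
    have leK : K <= k by lia.
    have [t [s' [E1 L1 [q0 q1 qm] q3 [q4 q2]]]] := bodyP s K r0 r1 mm r2 leK r3.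
    have Kk' : K = k by lia.
    rewrite Kk' goodk /= addn0 in q3 q4 q2.
    exists (t + 1).+1, s', k; split=> //; last by lia.
    by apply: exec_while_true E1 (exec_while_false _ _); rewrite ?r4.
  have leK : K <= k by lia.
  have [t [s' [E1 L1 [q0 q1 qm] q3 [q4 q2]]]] := bodyP s K r0 r1 mm r2 leK r3.
  case gK : (good K) q4 q2 => /= q4 q2.
    exists (t + 1).+1, s', K; split=> //; [|by split=> //; lia|].
      by apply: exec_while_true E1 (exec_while_false _ _); rewrite ?r4.
    by rewrite mulSn; lia.
  have [||t2 [s2 [K' [E2 gK' i2 j2 L2]]]] := IH s' (K + 1) _ q0 q1 qm q2 _ q4.
  - by lia.
  - by rewrite q3 leq_search_size.
  exists (t + t2).+1, s2, K'; split=> //; last by rewrite mulSn; lia.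
  by apply: exec_while_true E1 E2; rewrite r4.
pose s0 := coloring_input G l.
pose s1 := set_reg s0 2 0; pose s2 := set_reg s1 4 1.
have [t3 [s3 [K [E3 [gK leK] [q0 q1 qm] [q2 q3] L3]]]] :=
  loop k s2 0 (add0n k) erefl erefl erefl erefl (leq0n _) erefl.
have [t4 [s4 [E4 L4 V4 [A4 M4]]]] := RA s3.
pose s5 := set_reg s4 6 0; pose s6 := set_reg s5 0 (reg s5 5 + reg s5 6).
exists (1 + (1 + (t3 + (t4 + (1 + 1))))), s6; split.
- apply: exec_seq (exec_const _ _ _) _; apply: exec_seq (exec_const _ _ _) _.
  apply: exec_seq E3 _; apply: exec_seq E4 _.
  by apply: exec_seq (exec_const _ _ _) _; apply: exec_add.
- rewrite /accepts /= V4 addn0 q0 q1 q2 q3 qm certifiesE //.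
  by case: (colorable G l).
have le4 : t4 <= P.
  apply: leq_trans L4 (bound _ _ _ _ _ _); rewrite /C /g; [lia..|].
  by apply: (lew s3 K); rewrite ?q3 ?leq_search_size.
have P1 : 0 < W.+1 ^ g by rewrite expn_gt0.
have PE : P = C * W.+1 ^ g by [].
move: P1 PE; rewrite -/W; move: (W.+1 ^ g) => V P1 PE.
have -> : (3 * C + 20) * k.+1 * V = k.+1 * (3 * P + 20 * V).
  by rewrite PE; ring.
nia.
Qed.

(** The part of the time bound that depends on [k] alone. Of the [g.+1] factors
    [(8 * k + 3) ^ k.+1], one absorbs the [k.+1] passes and the others the polynomial of degree
    [g]. *)
Definition time_factor C g k := C.+1 * (8 * k + 3) ^ (k.+1 * g.+1).

Lemma time_factor_bound C g n k :
  C * k.+1 * (n + k + search_size k).+1 ^ g <= time_factor C g k * maxn 1 n ^ g.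
Proof.
set N := maxn 1 n; set b := 8 * k + 3.
(* The search size is at most [b ^ k]; the extra factor [b] leaves room for [k + 2]. *)
have size_le : k + search_size k + 2 <= b ^ k.+1.
  have : search_size k <= b ^ k.
    by rewrite search_sizeE /budget_base; apply: leq_expl; rewrite /b; lia.
  have : 0 < b ^ k by rewrite expn_gt0 /b; lia.
  by rewrite expnS; move: (b ^ k) (search_size k) => x y; rewrite /b; nia.
have sum_le : (n + k + search_size k).+1 <= b ^ k.+1 * N.
  apply: leq_trans (leq_mul size_le (leqnn N)).
  have : n <= N by rewrite leq_max leqnn orbT.
  have : 0 < N by rewrite leq_max.
  by move: N (search_size k) => N y; nia.
apply: leq_trans (leq_mul (leqnn _) (leq_expl g sum_le)) _.
rewrite expnMn mulnA leq_mul2r; apply/orP; right.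
have kb : k.+1 <= b ^ k.+1.
  by apply: leq_trans size_le; move: (search_size k) => y; lia.
rewrite /time_factor -/b expnM [_ ^ g.+1]expnS mulnA leq_mul2r; apply/orP; right.
by apply: leq_mul.
Qed.

(** For [k > 8] the base is at most [k ^ 2]; the exponent becomes [2 * (k.+1 * g.+1)], plus 1 for
    the constant [C.+1 <= k]. *)
Lemma time_factor_le C g k : C < k -> 8 < k ->
  time_factor C g k <= k ^ (k * (4 * g + 5)).
Proof.
move=> ltCk lt8k; rewrite /time_factor.
have base : 8 * k + 3 <= k ^ 2 by rewrite expnS expn1; nia.
apply: leq_trans (leq_mul ltCk (leq_expl _ base)) _.
rewrite -expnM -expnS; apply: leq_pexp2l; nia.
Qed.

(* The asymptotic form of the bound over the reals *)
From mathcomp Require Import all_order all_algebra.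
From mathcomp Require Import all_classical all_reals all_analysis.
Import Order.TTheory GRing.Theory Num.Theory numFieldNormedType.Exports.
Local Open Scope classical_set_scope.
Local Open Scope ring_scope.

Lemma log_time_factor_O (R : realType) C g :
  (fun k => ln ((time_factor C g k)%:R : R) / ln 2) =O_\oo (fun k : nat => k%:R * ln (k%:R : R)).
Proof.
have ln2 : 0 < ln (2 : R) by apply: ln_gt0; rewrite ltr1n.
(* The constant comes from [ln (k ^ (k * (4 * g + 5))) = (4 * g + 5) * k * ln k], converted to base
   2. *)
apply/eqO_exP; exists ((4 * g + 5)%:R / ln 2); first by rewrite divr_gt0 ?ltr0n ?addn_gt0 ?orbT.
near=> k.
have k9 : (8 < k)%N by near: k; apply: nbhs_infty_gt.
have kC : (C < k)%N by near: k; apply: nbhs_infty_gt.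
have k0 : (0 < k)%N by apply: leq_trans k9.
have T0 : (0 < time_factor C g k)%N by rewrite muln_gt0 expn_gt0 addn_gt0 orbT.
rewrite !ger0_norm; last 2 first.
- by rewrite mulr_ge0 ?ler0n // ln_ge0 // ler1n.
- by rewrite divr_ge0 ?(ltW ln2) // ln_ge0 // ler1n.
rewrite mulrAC ler_pM2r ?invr_gt0 //.
apply: (@le_trans _ _ (ln ((k ^ (k * (4 * g + 5)))%N%:R))).
  rewrite ler_ln ?posrE ?ltr0n ?expn_gt0 ?k0 //.
  by rewrite ler_nat time_factor_le.
by rewrite natrX lnXn ?ltr0n // -[leLHS]mulr_natl natrM mulrA [_%:R * k%:R]mulrC.
Unshelve. all: by end_near.
Qed.

Lemma powR2_log2 (R : realType) (x : R) : 0 < x -> 2 `^ (ln x / ln 2) = x.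
Proof.
move=> x0; have ln2 : 0 < ln (2 : R) by apply: ln_gt0; rewrite ltr1n.
by rewrite /powR pnatr_eq0 /= divfK ?gt_eqF // lnK.
Qed.

Theorem theorem4p2 (R : realType) :
  exists (A : cmd) (f : nat -> R) (d : nat),
    f =O_\oo (fun k : nat => k%:R * ln (k%:R : R)) /\
    forall (n : nat) (G : sgraph 'I_n) (l k : nat),
      (0 < l)%N -> chordal_ke k G ->
      exists (t : nat) (s : state),
        [/\ exec A (coloring_input G l) t s,
            accepts s = colorable G l
          & t%:R <= 2 `^ (f k) * (maxn 1 n)%:R ^+ d].
Proof.
have [A [C [g AP]]] := coloring_program.
(* With [f] the binary logarithm of [time_factor], the power of 2 in the bound is exactly
   [time_factor]. *)
exists A, (fun k => ln ((time_factor C g k)%:R : R) / ln 2), g.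
split=> [|n G l k _ /(AP n G l k)[t [s [E acc le]]]]; first exact: log_time_factor_O.
exists t, s; split=> //.
rewrite powR2_log2; last by rewrite ltr0n muln_gt0 expn_gt0 addn_gt0 orbT.
by rewrite -natrX -natrM ler_nat (leq_trans le) // time_factor_bound.
Qed.
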